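(* Let $\mathscr{B}=c_0$ with pointwise product, so that $\mathscr{B}^*=\ell_1$, and let $\mathscr{A}$ be the Banach space $\ell_1\oplus_1 c_0$ with the multiplication $$(x,\varphi)(y,\psi)=(x\psi+\varphi y,\ \varphi\psi),\qquad x,y\in\ell_1,\ \varphi,\psi\in c_0,$$ where $x\psi,\varphi y\in\ell_1$ are given by the natural right and left dual module actions of $c_0$ on $\ell_1$. Then the Banach algebra $\mathscr{A}$ has the following properties: (i) $\mathscr{A}$ is not weakly sequentially complete; (ii) $\mathscr{A}$ is not standard (i.e. is not a standard wscai algebra); (iii) $\mathscr{A}$ has a contractive approximate identity; (iv) $\mathscr{A}$ is a two-sided ideal in $\mathscr{A}^{**}$; (v) $\mathscr{A}$ contains a closed ideal $\mathcal{J}$ such that both $\mathcal{J}$ and $\mathscr{A}/\mathcal{J}$ are Arens regular; (vi) $\mathscr{A}$ is not Arens regular.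
   Context: For a Banach algebra $\mathscr{B}$, $x\in\mathscr{B}^*$ and $\varphi,\psi\in\mathscr{B}$, the right dual action is $\langle x\varphi,\psi\rangle=\langle x,\varphi\psi\rangle$ and the left dual action is $\langle\varphi x,\psi\rangle=\langle x,\psi\varphi\rangle$ (for $\mathscr{B}=c_0$ both are pointwise multiplication of sequences). $\oplus_1$ denotes the $\ell_1$-direct sum of Banach spaces (the norm of the sum of two components is the sum of their norms). ''Ideal'' means two-sided ideal. For a Banach algebra $\mathscr{A}$, $f\in\mathscr{A}^*$, $\varphi,\psi\in\mathscr{A}$ and $m,n\in\mathscr{A}^{**}$, the first Arens product $mn$ on $\mathscr{A}^{**}$ is given by $\langle f\cdot\varphi,\psi\rangle=\langle f,\varphi\psi\rangle$, $\langle n\cdot f,\varphi\rangle=\langle n,f\cdot\varphi\rangle$, $\langle mn,f\rangle=\langle m,n\cdot f\rangle$; the second Arens product $m\diamond n$ is given by $\langle\varphi\cdot f,\psi\rangle=\langle f,\psi\varphi\rangle$, $\langle f\cdot m,\varphi\rangle=\langle m,\varphi\cdot f\rangle$, $\langle m\diamond n,f\rangle=\langle n,f\cdot m\rangle$. Both make $\mathscr{A}^{**}$ a Banach algebra containing $\mathscr{A}$ as a subalgebra; unless indicated otherwise products in $\mathscr{A}^{**}$ are first Arens products. $\mathscr{A}$ is Arens regular if $mn=m\diamond n$ for all $m,n\in\mathscr{A}^{**}$. A contractive approximate identity is a two-sided approximate identity contained in the closed unit ball. A wscai algebra is a Banach algebra $\mathscr{A}$ that is weakly sequentially complete, is an ideal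 in $\mathscr{A}^{**}$, and has a contractive approximate identity. A mixed identity of $\mathscr{A}^{**}$ is an element which is a right identity for the first Arens product and a left identity for the second Arens product. A wscai algebra $\mathscr{A}$, with mixed identity $e$ of $\mathscr{A}^{**}$, is called standard if $e\mathscr{A}^{**}$ contains a closed vector subspace $\mathscr{C}$ such that $e\mathscr{A}^{**}=\mathscr{A}\oplus_1\mathscr{C}$. *)

(* Defs.v *)
From HB Require Import structures.
From mathcomp Require Import all_boot all_order all_algebra.
From mathcomp Require Import complex.
From mathcomp Require Import all_classical all_reals.
From mathcomp Require Import topology normedtype sequences.
From mathcomp Require Import ring.

Set Implicit Arguments.
Unset Strict Implicit.
Unset Printing Implicit Defensive.

Import Order.TTheory GRing.Theory Num.Theory.
Import numFieldNormedType.Exports.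

Local Open Scope classical_set_scope.
Local Open Scope ring_scope.
Local Open Scope complex_scope.

(* Scalars are complex: all spaces are normed modules over [R[i]], whose norms
   take their values in [R[i]]; [rnorm] is the norm seen as an element of [R],
   where suprema and infima are available (see [rnormE]). *)
Definition rnorm (R : realType) (V : normedModType R[i]) (x : V) : R :=
  complex.Re `|x|.
Arguments rnorm : simpl never.

Section RealNorm.
Context {R : realType}.
Implicit Types V : normedModType R[i].

Lemma rnormE V (x : V) : `|x| = (rnorm x)%:C.
Proof.
have := normr_ge0 x; rewrite /rnorm lecE => /andP[/eqP/= + _].
by case: `|x| => a b /= ->.
Qed.

Lemma rnorm_ge0 V (x : V) : 0 <= rnorm x.
Proof. by rewrite -ler0c -rnormE. Qed.

Lemma rnormD V (x y : V) : rnorm (x + y) <= rnorm x + rnorm y.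
Proof. by rewrite -lecR rmorphD/= -!rnormE ler_normD. Qed.

Lemma rnormZ V (a : R[i]) (x : V) :
  rnorm (a *: x) = rnorm (a : R[i]^o) * rnorm x.
Proof. by apply: complexI; rewrite rmorphM/= -!rnormE normrZ. Qed.

Lemma rnorm0 V : rnorm (0 : V) = 0.
Proof. by rewrite /rnorm normr0. Qed.

Lemma rnormN V (x : V) : rnorm (- x) = rnorm x.
Proof. by rewrite /rnorm normrN. Qed.

Lemma rnormB V (x y : V) : rnorm (x - y) = rnorm (y - x).
Proof. by rewrite -rnormN opprB. Qed.

Lemma rnorm0_eq0 V (x : V) : rnorm x = 0 -> x = 0.
Proof. by move=> x0; apply/normr0_eq0; rewrite rnormE x0. Qed.

Lemma ler_rnorm V (W : normedModType R[i]) (x : V) (y : W) : (`|x| <= `|y|) = (rnorm x <= rnorm y).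
Proof. by rewrite !rnormE lecR. Qed.

Lemma rnormM (a b : R[i]^o) :
  rnorm (a * b : R[i]^o) = rnorm a * rnorm b.
Proof. exact: rnormZ. Qed.

Lemma complex_gt0P (e : R[i]) : 0 < e -> exists2 r : R, 0 < r & e = r%:C.
Proof.
case: e => a b; rewrite ltcE/= => /andP[/eqP b0 a0]; exists a => //.
by rewrite b0.
Qed.

Lemma rnorm_bounded_continuous V (f : {linear V -> R[i]^o}) (M : R) :
  (forall x, rnorm (f x) <= M * rnorm x) -> continuous f.
Proof.
move=> fM; apply/linear_bounded_continuous/linear_boundedP.
exists (M%:C); split; first by rewrite realE lecE/= eqxx/= lecE/= eqxx/= le_total.
move=> r Mr x; rewrite (@le_trans _ _ (M%:C * `|x|))//; last first.
  by rewrite ler_wpM2r// ltW.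
by rewrite !rnormE -rmorphM/= lecR.
Qed.

Lemma rnorm_continuous_bounded V (f : {linear V -> R[i]^o}) :
  continuous f -> exists M : R, forall x, rnorm (f x) <= M * rnorm x.
Proof.
move=> /linear_bounded_continuous/linear_boundedP/pinfty_ex_gt0[M M0 fM].
have [r r0 Mr] := complex_gt0P M0; exists r => x.
by rewrite -lecR rmorphM/= -!rnormE -Mr.
Qed.

End RealNorm.

Section Dual.
Context {R : realType} (V : normedModType R[i]).

Definition is_dual (f : V -> R[i]^o) : Prop := linear f /\ continuous f.

Definition dual_pred : {pred V -> R[i]^o} := [pred f | `[< is_dual f >]].

Record dual := Dual { dual_fun :> V -> R[i]^o ; _ : dual_fun \in dual_pred }.

Implicit Types f g : dual.

HB.instance Definition _ := [isSub of dual for dual_fun].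
HB.instance Definition _ := [Choice of dual by <:].

Lemma dual_linear (f : dual) : linear f.
Proof. by case: f => f /= /asboolP[]. Qed.

Lemma dual_continuous (f : dual) : continuous f.
Proof. by case: f => f /= /asboolP[]. Qed.

HB.instance Definition _ (f : dual) :=
  GRing.isLinear.Build _ _ _ _ (dual_fun f) (dual_linear f).

Lemma dualP (f g : dual) : (forall x, f x = g x) -> f = g.
Proof. by move=> fg; apply/val_inj/funext. Qed.

Lemma dual_pred_submod_closed : submod_closed dual_pred.
Proof.
split.
  apply/asboolP; split; first by move=> a x y; rewrite /= scaler0 addr0.
  by move=> x; exact: cvg_cst.
move=> a f g /asboolP[lf cf] /asboolP[lg cg]; apply/asboolP; split.
  move=> b x y; rewrite !fctE lf lg !scalerDr !scalerA mulrC.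
  by rewrite addrACA.
by move=> x; apply: cvgD; [apply: cvgZr; exact: cf|exact: cg].
Qed.

HB.instance Definition _ :=
  GRing.isSubmodClosed.Build _ _ dual_pred dual_pred_submod_closed.
HB.instance Definition _ := [SubChoice_isSubLmodule of dual by <:].

Lemma dualDE (f g : dual) x : (f + g) x = f x + g x.
Proof. by []. Qed.

Lemma dualZE a (f : dual) x : (a *: f) x = a *: f x.
Proof. by []. Qed.

Lemma dual_fun_bounded (f : dual) :
  exists M : R, forall x, rnorm (f x) <= M * rnorm x.
Proof.
exact: (@rnorm_continuous_bounded _ _ (dual_fun f) (@dual_continuous f)).
Qed.

Definition opnorm (f : dual) : R :=
  sup [set rnorm (f x) | x in [set x : V | rnorm x <= 1]].

Let opnorm_has_sup (f : dual) :
  has_sup [set rnorm (f x) | x in [set x : V | rnorm x <= 1]].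
Proof.
split; first by exists (rnorm (f 0)), 0 => //=; rewrite rnorm0.
have [M fM] := dual_fun_bounded f; exists `|M| => _ [x /= x1 <-].
rewrite (le_trans (fM x))// (le_trans (ler_norm _))// normrM.
by rewrite ler_piMr// ger0_norm// rnorm_ge0.
Qed.

Lemma opnorm_ge0 f : 0 <= opnorm f.
Proof.
apply: (le_trans (rnorm_ge0 (f 0))); apply: (ub_le_sup (opnorm_has_sup f).2).
by exists 0 => //=; rewrite rnorm0.
Qed.

Lemma opnormP f x : rnorm (f x) <= opnorm f * rnorm x.
Proof.
have [->|x0] := eqVneq x 0; first by rewrite linear0 !rnorm0 mulr0.
have nx0 : 0 < rnorm x.
  by rewrite lt0r rnorm_ge0 andbT; apply: contra x0 => /eqP/rnorm0_eq0/eqP.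
have Cn (r : R) : 0 <= r -> rnorm (r%:C : R[i]^o) = r.
  by move=> r0; rewrite /rnorm ger0_norm// ler0c.
rewrite -ler_pdivrMr// mulrC -(Cn (rnorm x)^-1) ?invr_ge0 ?rnorm_ge0//.
rewrite -rnormZ -linearZ/=; apply: (ub_le_sup (opnorm_has_sup f).2).
exists ((rnorm x)^-1%:C *: x) => //=.
by rewrite rnormZ Cn ?invr_ge0 ?rnorm_ge0// mulVf ?gt_eqF.
Qed.

Lemma opnorm_le f (M : R) : (forall x, rnorm x <= 1 -> rnorm (f x) <= M) ->
  opnorm f <= M.
Proof.
move=> fM; apply: ge_sup; first exact: (opnorm_has_sup f).1.
by move=> _ [x /= x1 <-]; exact: fM.
Qed.

Lemma opnormD f g : (opnorm (f + g))%:C <= (opnorm f)%:C + (opnorm g)%:C.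
Proof.
rewrite -rmorphD/= lecR; apply: opnorm_le => x x1; rewrite dualDE.
rewrite (le_trans (rnormD _ _))// lerD// (le_trans (opnormP _ _))//.
  by rewrite ler_piMr// opnorm_ge0.
by rewrite ler_piMr// opnorm_ge0.
Qed.

Lemma opnormZ a f : (opnorm (a *: f))%:C = `|a| * (opnorm f)%:C.
Proof.
have le b g : opnorm (b *: g) <= rnorm (b : R[i]^o) * opnorm g.
  apply: opnorm_le => x x1; rewrite dualZE rnormZ ler_wpM2l ?rnorm_ge0//.
  by rewrite (le_trans (opnormP _ _))// ler_piMr// opnorm_ge0.
rewrite -[`|a|](@rnormE R (R[i]^o)) -rmorphM/=; congr (_%:C).
apply/eqP; rewrite eq_le le/=.
have [->|a0] := eqVneq a 0.
  by rewrite [X in X * _](@rnorm0 R (R[i]^o)) mul0r opnorm_ge0.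
have na0 : 0 < rnorm (a : R[i]^o).
  rewrite lt0r rnorm_ge0 andbT; apply: contra a0 => /eqP.
  by move/(@rnorm0_eq0 R (R[i]^o))/eqP.
rewrite mulrC -ler_pdivlMr// -[leLHS](_ : opnorm (a^-1 *: (a *: f)) = _); last first.
  by rewrite scalerA mulVf// scale1r.
rewrite (le_trans (le _ _))// mulrC ler_wpM2l ?opnorm_ge0//.
rewrite -(ler_pM2r na0) -(@rnormM R) mulVf// mulVf ?gt_eqF//.
by rewrite /rnorm normr1.
Qed.

Lemma opnorm0_eq0 f : (opnorm f)%:C = 0 -> f = 0.
Proof.
case=> f0; apply/dualP => x; apply/rnorm0_eq0/eqP.
by rewrite eq_le rnorm_ge0 andbT (le_trans (opnormP _ _))// f0 mul0r.
Qed.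

HB.instance Definition _ :=
  @Lmodule_isNormed.Build R[i] dual (fun f => (opnorm f)%:C)
    opnormD opnormZ opnorm0_eq0.

Lemma rnorm_dualE (f : dual) : rnorm f = opnorm f.
Proof. by []. Qed.

Lemma dual_rnorm_le (f : dual) x : rnorm (f x) <= rnorm f * rnorm x.
Proof. exact: opnormP. Qed.

Definition mk_dual (f : V -> R[i]^o) (lf : linear f)
    (bf : exists M : R, forall x, rnorm (f x) <= M * rnorm x) : dual.
Proof.
apply: (@Dual f); apply/asboolP; split => //.
pose g : {linear V -> R[i]^o} := HB.pack f (GRing.isLinear.Build _ _ _ _ _ lf).
by have [M fM] := bf; apply: (@rnorm_bounded_continuous _ _ g M).
Defined.

Lemma mk_dualE f lf bf x : @mk_dual f lf bf x = f x.
Proof. by []. Qed.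

End Dual.

(* Algebras need not be unital, so the ring structures of the library do not
   apply. *)
HB.mixin Record NormedModule_isNormedAlgebra (K : numFieldType) A
    & NormedModule K A := {
  amul : A -> A -> A ;
  amulA : associative amul ;
  amulDl : left_distributive amul +%R ;
  amulDr : right_distributive amul +%R ;
  amulZl : forall (k : K) (a b : A), amul (k *: a) b = k *: amul a b ;
  amulZr : forall (k : K) (a b : A), amul a (k *: b) = k *: amul a b ;
  norm_amul : forall a b : A, `|amul a b| <= `|a| * `|b|
}.

#[short(type="normedAlgType")]
HB.structure Definition NormedAlgebra (K : numFieldType) :=
  {A of NormedModule K A & NormedModule_isNormedAlgebra K A}.

#[short(type="banachAlgType")]
HB.structure Definition BanachAlgebra (K : numFieldType) :=
  {A of NormedAlgebra K A & Complete A}.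

Reserved Notation "a ** b" (at level 40, left associativity).
Notation "a ** b" := (amul a b) : ring_scope.

Section AlgebraFacts.
Context {R : realType} (A : normedAlgType R[i]).

Lemma rnorm_amul (a b : A) : rnorm (a ** b) <= rnorm a * rnorm b.
Proof. by rewrite -lecR rmorphM/= -!rnormE norm_amul. Qed.

End AlgebraFacts.

Section Arens.
Context {R : realType} (A : normedAlgType R[i]).
Implicit Types (f : dual A) (a b : A) (m n : dual (dual A)).

Let dual_actr_linear f a : linear (fun b => f (a ** b)).
Proof. by move=> k b c; rewrite amulDr amulZr linearP. Qed.

Let dual_actr_le f a b : rnorm (f (a ** b)) <= rnorm f * rnorm a * rnorm b.
Proof.
rewrite (le_trans (dual_rnorm_le _ _))// -mulrA ler_wpM2l ?rnorm_ge0//.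
exact: rnorm_amul.
Qed.

(* [f . a], that is <f . a, b> = <f, a b>. *)
Definition dual_actr f a : dual A :=
  mk_dual (dual_actr_linear f a) (ex_intro _ _ (dual_actr_le f a)).

Let dual_actl_linear a f : linear (fun b => f (b ** a)).
Proof. by move=> k b c; rewrite amulDl amulZl linearP. Qed.

Let dual_actl_le a f b : rnorm (f (b ** a)) <= rnorm f * rnorm a * rnorm b.
Proof.
rewrite (le_trans (dual_rnorm_le _ _))// -mulrA ler_wpM2l ?rnorm_ge0//.
by rewrite mulrC rnorm_amul.
Qed.

(* [a . f], that is <a . f, b> = <f, b a>. *)
Definition dual_actl a f : dual A :=
  mk_dual (dual_actl_linear a f) (ex_intro _ _ (dual_actl_le a f)).

Lemma dual_actr_norm f a : rnorm (dual_actr f a) <= rnorm f * rnorm a.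
Proof.
rewrite rnorm_dualE; apply: opnorm_le => x x1.
rewrite (le_trans (dual_actr_le _ _ _))// ler_piMr// mulr_ge0//.
  exact: rnorm_ge0.
exact: rnorm_ge0.
Qed.

Lemma dual_actl_norm a f : rnorm (dual_actl a f) <= rnorm f * rnorm a.
Proof.
rewrite rnorm_dualE; apply: opnorm_le => x x1.
rewrite (le_trans (dual_actl_le _ _ _))// ler_piMr// mulr_ge0//.
  exact: rnorm_ge0.
exact: rnorm_ge0.
Qed.

Let bidual_actl_linear n f : linear (fun a => n (dual_actr f a)).
Proof.
move=> k a b; rewrite -linearP; congr (n _); apply/dualP => c.
by rewrite dualDE dualZE /= amulDl amulZl linearP.
Qed.

Let bidual_actl_le n f a :
  rnorm (n (dual_actr f a)) <= rnorm n * rnorm f * rnorm a.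
Proof.
rewrite (le_trans (dual_rnorm_le _ _))// -mulrA ler_wpM2l ?rnorm_ge0//.
exact: dual_actr_norm.
Qed.

(* [n . f], that is <n . f, a> = <n, f . a>. *)
Definition bidual_actl n f : dual A :=
  mk_dual (bidual_actl_linear n f) (ex_intro _ _ (bidual_actl_le n f)).

Let bidual_actr_linear f m : linear (fun a => m (dual_actl a f)).
Proof.
move=> k a b; rewrite -linearP; congr (m _); apply/dualP => c.
by rewrite dualDE dualZE /= amulDr amulZr linearP.
Qed.

Let bidual_actr_le f m a :
  rnorm (m (dual_actl a f)) <= rnorm m * rnorm f * rnorm a.
Proof.
rewrite (le_trans (dual_rnorm_le _ _))// -mulrA ler_wpM2l ?rnorm_ge0//.
exact: dual_actl_norm.
Qed.

(* [f . m], that is <f . m, a> = <m, a . f>. *)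
Definition bidual_actr f m : dual A :=
  mk_dual (bidual_actr_linear f m) (ex_intro _ _ (bidual_actr_le f m)).

Lemma bidual_actl_norm n f : rnorm (bidual_actl n f) <= rnorm n * rnorm f.
Proof.
rewrite rnorm_dualE; apply: opnorm_le => x x1.
rewrite (le_trans (bidual_actl_le _ _ _))// ler_piMr// mulr_ge0//.
  exact: rnorm_ge0.
exact: rnorm_ge0.
Qed.

Lemma bidual_actr_norm f m : rnorm (bidual_actr f m) <= rnorm m * rnorm f.
Proof.
rewrite rnorm_dualE; apply: opnorm_le => x x1.
rewrite (le_trans (bidual_actr_le _ _ _))// ler_piMr// mulr_ge0//.
  exact: rnorm_ge0.
exact: rnorm_ge0.
Qed.

Let arens1_linear m n : linear (fun f => m (bidual_actl n f) : R[i]^o).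
Proof.
move=> k f g; rewrite -linearP; congr (m _); apply/dualP => a.
rewrite dualDE dualZE /= -linearP; congr (n _).
exact/dualP.
Qed.

Let arens1_le m n f :
  rnorm (m (bidual_actl n f)) <= rnorm m * rnorm n * rnorm f.
Proof.
rewrite (le_trans (dual_rnorm_le _ _))// -mulrA ler_wpM2l ?rnorm_ge0//.
exact: bidual_actl_norm.
Qed.

(* First Arens product: <m n, f> = <m, n . f>. *)
Definition arens1 m n : dual (dual A) :=
  mk_dual (arens1_linear m n) (ex_intro _ _ (arens1_le m n)).

Let arens2_linear m n : linear (fun f => n (bidual_actr f m) : R[i]^o).
Proof.
move=> k f g; rewrite -linearP; congr (n _); apply/dualP => a.
rewrite dualDE dualZE /= -linearP; congr (m _).
exact/dualP.
Qed.

Let arens2_le m n f :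
  rnorm (n (bidual_actr f m)) <= rnorm n * rnorm m * rnorm f.
Proof.
rewrite (le_trans (dual_rnorm_le _ _))// -mulrA ler_wpM2l ?rnorm_ge0//.
exact: bidual_actr_norm.
Qed.

(* Second Arens product: <m <> n, f> = <n, f . m>. *)
Definition arens2 m n : dual (dual A) :=
  mk_dual (arens2_linear m n) (ex_intro _ _ (arens2_le m n)).

Definition arens_regular : Prop := forall m n, arens1 m n = arens2 m n.

End Arens.

Section CanonicalEmbedding.
Context {R : realType} (V : normedModType R[i]).

Let bidual_embed_linear (x : V) : linear (fun f : dual V => f x).
Proof. by []. Qed.

Let bidual_embed_le (x : V) (f : dual V) : rnorm (f x) <= rnorm x * rnorm f.
Proof. by rewrite mulrC dual_rnorm_le. Qed.

Definition bidual_embed (x : V) : dual (dual V) :=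
  mk_dual (bidual_embed_linear x) (ex_intro _ _ (bidual_embed_le x)).

End CanonicalEmbedding.

Section Properties.
Context {R : realType}.

Definition weakly_cauchy (V : normedModType R[i]) (u : nat -> V) : Prop :=
  forall f : dual V, cauchy ((f (u k) : R[i]^o) @[k --> \oo]).

Definition weakly_cvg_to (V : normedModType R[i]) (u : nat -> V) (x : V) :=
  forall f : dual V, (f (u k) : R[i]^o) @[k --> \oo] --> f x.

Definition weakly_sequentially_complete (V : normedModType R[i]) : Prop :=
  forall u : nat -> V, weakly_cauchy u -> exists x, weakly_cvg_to u x.

Definition directed (I : Type) (le : I -> I -> Prop) : Prop :=
  [/\ inhabited I, forall i, le i i,
      forall i j k, le i j -> le j k -> le i k
    & forall i j, exists k, le i k /\ le j k].

(* A net indexed by [I] converges when it converges along this filter. *)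
Definition tails (I : Type) (le : I -> I -> Prop) : set_system I :=
  [set S | exists i, forall j, le i j -> S j].

Definition has_contractive_ai (A : normedAlgType R[i]) : Prop :=
  exists (I : Type) (le : I -> I -> Prop) (e : I -> A),
    [/\ directed le, forall i, `|e i| <= 1 &
        forall a : A, (e i ** a) @[i --> tails le] --> a /\
                      (a ** e i) @[i --> tails le] --> a].

Definition ideal_in_bidual (A : normedAlgType R[i]) : Prop :=
  forall (a : A) (m : dual (dual A)),
    (exists b, arens1 (bidual_embed a) m = bidual_embed b) /\
    (exists b, arens1 m (bidual_embed a) = bidual_embed b).

Definition wscai (A : banachAlgType R[i]) : Prop :=
  [/\ weakly_sequentially_complete A, ideal_in_bidual A
    & has_contractive_ai A].

Definition mixed_identity (A : normedAlgType R[i]) (e : dual (dual A)) :=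
  (forall m, arens1 m e = m) /\ (forall m, arens2 e m = m).

Definition vector_subspace (V : lmodType R[i]) (C : set V) : Prop :=
  C 0 /\ forall (k : R[i]) x y, C x -> C y -> C (k *: x + y).

(* Internal l_1-direct sum: directness follows from the norm identity. *)
Definition is_l1_sum (V : normedModType R[i]) (S U W : set V) : Prop :=
  S = [set u + w | u in U & w in W] /\
  forall u w, U u -> W w -> `|u + w| = `|u| + `|w|.

(* The mixed identity of the bidual need not be unique. *)
Definition standard (A : banachAlgType R[i]) : Prop :=
  wscai A /\
  exists e : dual (dual A), mixed_identity e /\
  let eA2 := range (arens1 e) in
  exists C : set (dual (dual A)),
    [/\ closed C, vector_subspace C, C `<=` eA2
      & is_l1_sum eA2 (range (@bidual_embed R A)) C].

End Properties.

Record closed_ideal (R : realType) (A : normedAlgType R[i]) := ClosedIdeal {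
  ideal_set :> set A ;
  ideal_closed : closed ideal_set ;
  ideal_subspace : vector_subspace ideal_set ;
  ideal_mull : forall a x, ideal_set x -> ideal_set (a ** x) ;
  ideal_mulr : forall a x, ideal_set x -> ideal_set (x ** a)
}.

Section Ideal.
Context {R : realType} {A : normedAlgType R[i]} (J : closed_ideal A).

Definition ideal_pred : {pred A} := [pred x | `[< ideal_set J x >]].

Lemma ideal_pred_submod_closed : submod_closed ideal_pred.
Proof.
have [J0 JD] := ideal_subspace J; split; first exact/asboolP.
by move=> k x y /asboolP Jx /asboolP Jy; apply/asboolP/JD.
Qed.

HB.instance Definition _ :=
  GRing.isSubmodClosed.Build _ _ ideal_pred ideal_pred_submod_closed.

Record ideal_type := IdealType
  { ideal_val :> A ; _ : ideal_val \in ideal_pred }.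

HB.instance Definition _ := [isSub of ideal_type for ideal_val].
HB.instance Definition _ := [Choice of ideal_type by <:].
HB.instance Definition _ := [SubChoice_isSubLmodule of ideal_type by <:].

Implicit Types x y : ideal_type.

Let ideal_normD x y : `|val (x + y)| <= `|val x| + `|val y|.
Proof. exact: ler_normD. Qed.

Let ideal_normZ (k : R[i]) x : `|val (k *: x)| = `|k| * `|val x|.
Proof. exact: normrZ. Qed.

Let ideal_norm_eq0 x : `|val x| = 0 -> x = 0.
Proof. by move=> /normr0_eq0 x0; exact/val_inj. Qed.

HB.instance Definition _ :=
  @Lmodule_isNormed.Build R[i] ideal_type (fun x => `|val x|)
    ideal_normD ideal_normZ ideal_norm_eq0.

Let ideal_mul_subproof x y : val x ** val y \in ideal_pred.
Proof. by case: x => x /= /asboolP Jx; apply/asboolP/ideal_mulr. Qed.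

Definition ideal_mul x y : ideal_type := IdealType (ideal_mul_subproof x y).

Let ideal_mulA : associative ideal_mul.
Proof. by move=> x y z; apply/val_inj; rewrite /= amulA. Qed.
Let ideal_mulDl : left_distributive ideal_mul +%R.
Proof. by move=> x y z; apply/val_inj; rewrite /= amulDl. Qed.
Let ideal_mulDr : right_distributive ideal_mul +%R.
Proof. by move=> x y z; apply/val_inj; rewrite /= amulDr. Qed.
Let ideal_mulZl (k : R[i]) x y : ideal_mul (k *: x) y = k *: ideal_mul x y.
Proof. by apply/val_inj; rewrite /= amulZl. Qed.
Let ideal_mulZr (k : R[i]) x y : ideal_mul x (k *: y) = k *: ideal_mul x y.
Proof. by apply/val_inj; rewrite /= amulZr. Qed.
Let ideal_norm_mul x y : `|ideal_mul x y| <= `|x| * `|y|.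
Proof. exact: norm_amul. Qed.

HB.instance Definition _ :=
  NormedModule_isNormedAlgebra.Build R[i] ideal_type ideal_mulA ideal_mulDl
    ideal_mulDr ideal_mulZl ideal_mulZr ideal_norm_mul.

End Ideal.

Section Quotient.
Context {R : realType} {A : normedAlgType R[i]} (J : closed_ideal A).

Local Open Scope quotient_scope.

Definition quotient_type : Type := Quotient.quot (@ideal_pred R A J).

HB.instance Definition _ := GRing.Zmodule.on quotient_type.

Definition quotient_map (a : A) : quotient_type :=
  \pi_(Quotient.quot (@ideal_pred R A J)) a.

Local Notation pi := quotient_map.

Implicit Types q r : quotient_type.

Lemma quotient_mapP a b : pi a = pi b <-> ideal_set J (a - b).
Proof.
rewrite /quotient_map; split.
  by move=> /eqP; rewrite -Quotient.idealrBE => /asboolP.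
by move=> Jab; apply/eqP; rewrite -Quotient.idealrBE; apply/asboolP.
Qed.

Lemma quotient_map_surj q : exists a, q = pi a.
Proof.
exists (repr (q : Quotient.quot (@ideal_pred R A J))).
by rewrite /quotient_map reprK.
Qed.

Lemma quotient_mapD a b : pi (a + b) = pi a + pi b.
Proof. exact: pi_addr. Qed.

Definition quotient_repr q : A := xget 0 [set a | pi a = q].

Lemma quotient_reprK q : pi (quotient_repr q) = q.
Proof.
have [a ->] := quotient_map_surj q.
by rewrite /quotient_repr; case: xgetP => //= /(_ a).
Qed.

Definition quotient_scale (k : R[i]) q : quotient_type :=
  pi (k *: quotient_repr q).

Definition quotient_mul q r : quotient_type :=
  pi (quotient_repr q ** quotient_repr r).

Lemma quotient_mapZ k a : quotient_scale k (pi a) = pi (k *: a).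
Proof.
apply/quotient_mapP; have /quotient_mapP Ja := quotient_reprK (pi a).
have [J0 JD] := ideal_subspace J.
by rewrite -scalerBr -[X in ideal_set J X]addr0; exact: JD.
Qed.

Lemma quotient_mapM a b : quotient_mul (pi a) (pi b) = pi (a ** b).
Proof.
have amulNl (x y : A) : (- x) ** y = - (x ** y).
  by rewrite -scaleN1r amulZl scaleN1r.
have amulNr (x y : A) : x ** (- y) = - (x ** y).
  by rewrite -scaleN1r amulZr scaleN1r.
apply/quotient_mapP.
have /quotient_mapP Ja := quotient_reprK (pi a).
have /quotient_mapP Jb := quotient_reprK (pi b).
set a' := quotient_repr _ in Ja *; set b' := quotient_repr _ in Jb *.
have [J0 JD] := ideal_subspace J.
rewrite (_ : _ - _ = 1 *: ((a' - a) ** b') + a ** (b' - b)); last first.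
  by rewrite scale1r amulDl amulDr amulNl amulNr addrA subrK.
by apply: JD; [exact: ideal_mulr|exact: ideal_mull].
Qed.

Let quotient_scaleA k l q :
  quotient_scale k (quotient_scale l q) = quotient_scale (k * l) q.
Proof.
by have [a ->] := quotient_map_surj q; rewrite !quotient_mapZ scalerA.
Qed.

Let quotient_scale1 : left_id 1 quotient_scale.
Proof.
by move=> q; have [a ->] := quotient_map_surj q; rewrite quotient_mapZ scale1r.
Qed.

Let quotient_scaleDr : right_distributive quotient_scale +%R.
Proof.
move=> k q r; have [a ->] := quotient_map_surj q.
have [b ->] := quotient_map_surj r.
by rewrite -quotient_mapD !quotient_mapZ scalerDr quotient_mapD.
Qed.

Let quotient_scaleDl q : {morph quotient_scale^~ q : k l / k + l}.
Proof.
move=> k l; have [a ->] := quotient_map_surj q.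
by rewrite !quotient_mapZ scalerDl quotient_mapD.
Qed.

HB.instance Definition _ :=
  GRing.Zmodule_isLmodule.Build R[i] quotient_type quotient_scaleA
    quotient_scale1 quotient_scaleDr quotient_scaleDl.

Lemma quotient_mapZE k a : pi (k *: a) = k *: pi a.
Proof. by rewrite -quotient_mapZ. Qed.

Definition quotient_norm q : R := inf [set rnorm a | a in [set a | pi a = q]].

Let quotient_norm_has_inf q : has_inf [set rnorm a | a in [set a | pi a = q]].
Proof.
split; last by exists 0 => _ [a _ <-]; exact: rnorm_ge0.
by have [a ->] := quotient_map_surj q; exists (rnorm a), a.
Qed.

Lemma quotient_norm_le a : quotient_norm (pi a) <= rnorm a.
Proof.
by apply: ge_inf; [exact: (quotient_norm_has_inf _).2|exists a].
Qed.

Lemma quotient_norm_ge0 q : 0 <= quotient_norm q.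
Proof.
apply: lb_le_inf; first exact: (quotient_norm_has_inf q).1.
by move=> _ [a _ <-]; exact: rnorm_ge0.
Qed.

Lemma quotient_norm_approx q (e : R) : 0 < e ->
  exists a, pi a = q /\ rnorm a < quotient_norm q + e.
Proof.
move=> e0; have [_ [a /= aq <-] ae] := inf_adherent e0 (quotient_norm_has_inf q).
by exists a.
Qed.

Let quotient_normD q r :
  (quotient_norm (q + r))%:C <= (quotient_norm q)%:C + (quotient_norm r)%:C.
Proof.
rewrite -rmorphD/= lecR; apply/ler_addgt0Pr => e e0.
have [a [<- ae]] := quotient_norm_approx q (divr_gt0 e0 (ltr0n R 2)).
have [b [<- be]] := quotient_norm_approx r (divr_gt0 e0 (ltr0n R 2)).
rewrite -quotient_mapD (le_trans (quotient_norm_le _))//.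
rewrite (le_trans (rnormD _ _))// [in leRHS](splitr e) addrACA.
by rewrite lerD// ltW.
Qed.

Let quotient_normZ (k : R[i]) q :
  (quotient_norm (k *: q))%:C = `|k| * (quotient_norm q)%:C.
Proof.
have le (l : R[i]) r :
    quotient_norm (l *: r) <= rnorm (l : R[i]^o) * quotient_norm r.
  apply/ler_addgt0Pr => e e0.
  have k1 : 0 < rnorm (l : R[i]^o) + 1 by rewrite ltr_wpDl// rnorm_ge0.
  have [a [ar ae]] := quotient_norm_approx r (divr_gt0 e0 k1).
  rewrite -ar -quotient_mapZE (le_trans (quotient_norm_le _))// rnormZ.
  rewrite (le_trans (ler_wpM2l (rnorm_ge0 _) (ltW ae)))// ar mulrDr lerD2l.
  rewrite mulrCA ler_piMr ?(ltW e0)// ler_pdivrMr// mul1r lerDl//.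
rewrite -[`|k|](@rnormE R (R[i]^o)) -rmorphM/=; congr (_%:C).
apply/eqP; rewrite eq_le le/=.
have [->|k0] := eqVneq k 0.
  by rewrite [X in X * _](@rnorm0 R (R[i]^o)) mul0r quotient_norm_ge0.
have nk0 : 0 < rnorm (k : R[i]^o).
  rewrite lt0r rnorm_ge0 andbT; apply: contra k0 => /eqP.
  by move/(@rnorm0_eq0 R (R[i]^o))/eqP.
rewrite mulrC -ler_pdivlMr//.
rewrite -[leLHS](_ : quotient_norm (k^-1 *: (k *: q)) = _); last first.
  by rewrite scalerA mulVf// scale1r.
rewrite (le_trans (le _ _))// mulrC ler_wpM2l ?quotient_norm_ge0//.
rewrite -(ler_pM2r nk0) -(@rnormM R) mulVf// mulVf ?gt_eqF//.
by rewrite /rnorm normr1.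
Qed.

Let quotient_norm_eq0 q : (quotient_norm q)%:C = 0 -> q = 0.
Proof.
have pi0 : pi 0 = 0 by apply: (addrI (pi 0)); rewrite -quotient_mapD !addr0.
have [a ->] := quotient_map_surj q => -[a0].
rewrite -pi0; apply/quotient_mapP; rewrite subr0.
apply: ideal_closed => B /nbhs_normP[/= e e0 aB].
have [d d0 ed] := complex_gt0P e0.
have [b [/quotient_mapP Jba bd]] := quotient_norm_approx (pi a) d0.
have [J0 JD] := ideal_subspace J.
exists (a - b); split.
  rewrite -[X in ideal_set J X]addr0 -(opprB b) -scaleN1r; exact: JD.
apply: aB => /=; rewrite opprB addrC subrK ed rnormE ltcR.
by move: bd; rewrite a0 add0r.
Qed.

HB.instance Definition _ :=
  @Lmodule_isNormed.Build R[i] quotient_type (fun q => (quotient_norm q)%:C)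
    quotient_normD quotient_normZ quotient_norm_eq0.

Lemma rnorm_quotientE q : rnorm q = quotient_norm q.
Proof. by []. Qed.

Let quotient_mulA : associative quotient_mul.
Proof.
move=> q r s; have [a ->] := quotient_map_surj q.
have [b ->] := quotient_map_surj r; have [c ->] := quotient_map_surj s.
by rewrite !quotient_mapM amulA.
Qed.

Let quotient_mulDl : left_distributive quotient_mul +%R.
Proof.
move=> q r s; have [a ->] := quotient_map_surj q.
have [b ->] := quotient_map_surj r; have [c ->] := quotient_map_surj s.
by rewrite -quotient_mapD !quotient_mapM -quotient_mapD amulDl.
Qed.

Let quotient_mulDr : right_distributive quotient_mul +%R.
Proof.
move=> q r s; have [a ->] := quotient_map_surj q.
have [b ->] := quotient_map_surj r; have [c ->] := quotient_map_surj s.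
by rewrite -quotient_mapD !quotient_mapM -quotient_mapD amulDr.
Qed.

Let quotient_mulZl (k : R[i]) q r :
  quotient_mul (k *: q) r = k *: quotient_mul q r.
Proof.
have [a ->] := quotient_map_surj q; have [b ->] := quotient_map_surj r.
by rewrite -quotient_mapZE !quotient_mapM -quotient_mapZE amulZl.
Qed.

Let quotient_mulZr (k : R[i]) q r :
  quotient_mul q (k *: r) = k *: quotient_mul q r.
Proof.
have [a ->] := quotient_map_surj q; have [b ->] := quotient_map_surj r.
by rewrite -quotient_mapZE !quotient_mapM -quotient_mapZE amulZr.
Qed.

Let quotient_norm_mul q r : `|quotient_mul q r| <= `|q| * `|r|.
Proof.
rewrite !rnormE -rmorphM/= lecR !rnorm_quotientE.
set x := quotient_norm q; set y := quotient_norm r.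
have x0 : 0 <= x by exact: quotient_norm_ge0.
have y0 : 0 <= y by exact: quotient_norm_ge0.
apply/ler_addgt0Pr => e e0.
have M0 : 0 < x + y + 1 by rewrite ltr_wpDl// addr_ge0.
pose d := Num.min 1 (e / (x + y + 1)).
have d0 : 0 < d by rewrite /d lt_min ltr01 divr_gt0.
have d1 : d <= 1 by rewrite /d ge_min lexx.
have de : d * (x + y + 1) <= e by rewrite -ler_pdivlMr// /d ge_min lexx orbT.
have [a [aq ad]] := quotient_norm_approx q d0.
have [b [bq bd]] := quotient_norm_approx r d0.
rewrite -aq -bq quotient_mapM (le_trans (quotient_norm_le _))//.
rewrite (le_trans (rnorm_amul _ _))//.
rewrite (@le_trans _ _ ((x + d) * (y + d)))//.
  by rewrite ler_pM ?rnorm_ge0// ltW.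
rewrite mulrDl !mulrDr -addrA lerD2l (le_trans _ de)// !mulrDr mulr1.
rewrite [x * d]mulrC addrA lerD2l.
by rewrite ler_piMr// ltW.
Qed.

HB.instance Definition _ :=
  NormedModule_isNormedAlgebra.Build R[i] quotient_type quotient_mulA
    quotient_mulDl quotient_mulDr quotient_mulZl quotient_mulZr
    quotient_norm_mul.

End Quotient.

Section Completeness.
Context {R : realType}.

Lemma cauchy_rnorm (V : normedModType R[i]) (F : set_system V) :
  ProperFilter F -> cauchy F ->
  forall e : R, 0 < e -> exists x, F [set y | rnorm (x - y) < e].
Proof.
move=> FF /cauchyP cF e e0.
have e0' : 0 < e%:C by rewrite ltcR.
have [x Fx] := cF _ e0'; exists x; apply: filterS Fx => y.
by rewrite -ball_normE/= rnormE ltcR.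
Qed.

Lemma cvg_rnorm (V : normedModType R[i]) (F : set_system V) (x : V) :
  ProperFilter F -> (forall e : R, 0 < e -> F [set y | rnorm (x - y) <= e]) ->
  F --> x.
Proof.
move=> FF Fx; apply/(@cvgrPdist_le _ _ _ F FF id) => e /complex_gt0P[r r0 ->].
by apply: filterS (Fx _ r0) => y /=; rewrite rnormE lecR.
Qed.

Lemma cvg_rnormP (V : normedModType R[i]) (F : set_system V) (x : V) :
  ProperFilter F -> F --> x ->
  forall e : R, 0 < e -> F [set y | rnorm (x - y) <= e].
Proof.
move=> FF /(@cvgrPdist_le _ _ _ F FF id) Fx e e0.
have e0' : 0 < e%:C by rewrite ltcR.
by apply: filterS (Fx _ e0') => y /=; rewrite rnormE lecR.
Qed.

Lemma rnorm_Re (z : R[i]^o) : `|complex.Re z| <= rnorm z.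
Proof.
case: z => a b; rewrite -[rnorm _]/(Num.sqrt (a ^+ 2 + b ^+ 2)) /=.
by rewrite -sqrtr_sqr ler_wsqrtr// lerDl sqr_ge0.
Qed.

Lemma rnorm_Im (z : R[i]^o) : `|complex.Im z| <= rnorm z.
Proof.
case: z => a b; rewrite -[rnorm _]/(Num.sqrt (a ^+ 2 + b ^+ 2)) /=.
by rewrite -sqrtr_sqr ler_wsqrtr// lerDr sqr_ge0.
Qed.

Lemma rnorm_ReIm (z : R[i]^o) :
  rnorm z <= `|complex.Re z| + `|complex.Im z|.
Proof.
case: z => a b; rewrite -[rnorm _]/(Num.sqrt (a ^+ 2 + b ^+ 2)) /=.
rewrite -(@ler_pXn2r _ 2) ?nnegrE ?sqrtr_ge0 ?addr_ge0//.
rewrite sqr_sqrtr ?addr_ge0 ?sqr_ge0// sqrrD !real_normK ?num_real//.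
by rewrite lerD2r lerDl mulrn_wge0// mulr_ge0.
Qed.

Lemma complex_cauchy_cvg (F : set_system R[i]^o) :
  ProperFilter F -> cauchy F ->
  exists z, forall e : R, 0 < e -> F [set y | rnorm (z - y : R[i]^o) <= e].
Proof.
move=> FF cF.
have part (p : R[i]^o -> R) : (forall x y, p (x - y) = p x - p y) ->
    (forall z, `|p z| <= rnorm z) ->
    exists a, forall e : R, 0 < e -> F [set y | `|a - p y| <= e].
  move=> pB ple; have /cvg_ex[/= a pa] : cvg (p @ F).
    apply: R_complete; apply/cauchyP => e e0.
    have [x Fx] := cauchy_rnorm FF cF e0; exists (p x).
    rewrite /nbhs/= /fmap/=; apply: filterS Fx => y /= xy.
    by rewrite -ball_normE/= -pB (le_lt_trans (ple _)).
  by exists a => e e0; move/cvgrPdist_le : pa => /(_ _ e0).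
have [|a Fa] := part (@complex.Re R) _ rnorm_Re; first by move=> [? ?] [? ?].
have [|b Fb] := part (@complex.Im R) _ rnorm_Im; first by move=> [? ?] [? ?].
exists (a +i* b) => e e0.
have e2 : 0 < e / 2 by rewrite divr_gt0.
apply: filterS2 (Fa _ e2) (Fb _ e2) => -[c d] /= ac bd.
by rewrite (le_trans (rnorm_ReIm _))//= [leRHS]splitr lerD.
Qed.

(* A Cauchy filter of sequences, for a norm dominating the coordinates, has
   a pointwise limit. *)
Lemma coordinatewise_limit (V : normedModType R[i])
    (c : V -> nat -> R[i]^o) (F : set_system V) :
  (forall x y n, c (x - y) n = c x n - c y n) ->
  (forall x n, rnorm (c x n) <= rnorm x) ->
  ProperFilter F -> cauchy F ->
  exists l : nat -> R[i]^o, forall n (e : R), 0 < e ->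
    F [set y | rnorm (l n - c y n) <= e].
Proof.
move=> cB cle FF cF.
suff /choice[l lP] : forall n, exists z : R[i]^o, forall e : R, 0 < e ->
  F [set y | rnorm (z - c y n) <= e] by exists l.
move=> n; have [|z Fz] := @complex_cauchy_cvg ((c ^~ n) @ F) _.
  apply/cauchyP => e /complex_gt0P[r r0 ->].
  have [x Fx] := cauchy_rnorm FF cF r0; exists (c x n).
  rewrite /nbhs/= /fmap/=; apply: filterS Fx => y /= xy.
  by rewrite -ball_normE/= rnormE ltcR -cB (le_lt_trans (cle _ _)).
by exists z => e /Fz.
Qed.

End Completeness.

Section C0.
Variable R : realType.

Definition c0_pred : {pred nat -> R[i]^o} :=
  [pred x | `[< x @ \oo --> (0 : R[i]^o) >]].

Lemma c0_submod_closed : submod_closed c0_pred.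
Proof.
split; first by apply/asboolP; exact: cvg_cst.
move=> k x y /asboolP x0 /asboolP y0; apply/asboolP.
rewrite -[X in _ --> X]addr0 -[X in _ --> X + _](scaler0 _ k).
by apply: cvgD; [apply: cvgZr; exact: x0|exact: y0].
Qed.

HB.instance Definition _ :=
  GRing.isSubmodClosed.Build _ _ c0_pred c0_submod_closed.

Record c0 := C0 { c0_seq :> nat -> R[i]^o ; _ : c0_seq \in c0_pred }.

HB.instance Definition _ := [isSub of c0 for c0_seq].
HB.instance Definition _ := [Choice of c0 by <:].
HB.instance Definition _ := [SubChoice_isSubLmodule of c0 by <:].

Implicit Types x y z : c0.

Lemma c0_eqP x y : (forall n, x n = y n) -> x = y.
Proof. by move=> xy; exact/val_inj/funext. Qed.

Lemma c0_cvg x : c0_seq x @ \oo --> (0 : R[i]^o).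
Proof. by case: x => x /= /asboolP. Qed.

Lemma c0_bounded x : exists M : R, forall n, rnorm (x n) <= M.
Proof.
have /cvgrPdist_le/(_ 1 ltr01)[N _ xN] := @c0_cvg x.
pose S := \sum_(i < N) rnorm (x i).
have S0 : 0 <= S by apply: sumr_ge0 => i _; exact: rnorm_ge0.
exists (1 + S) => n; have [nN|Nn] := ltnP n N.
  rewrite /S (bigD1 (Ordinal nN))//= addrCA lerDl addr_ge0// sumr_ge0// => i _.
  exact: rnorm_ge0.
rewrite ler_wpDr//; have := xN _ Nn; rewrite /= sub0r normrN rnormE.
by rewrite -(rmorph1 (real_complex R)) lecR.
Qed.

Definition c0_norm x : R := sup (range (fun n => rnorm (x n))).

Let c0_has_sup x : has_sup (range (fun n => rnorm (x n))).
Proof.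
split; first by exists (rnorm (x 0)), 0%N.
by have [M xM] := c0_bounded x; exists M => _ [n _ <-].
Qed.

Lemma c0_norm_ge x n : rnorm (x n) <= c0_norm x.
Proof. by apply: (ub_le_sup (c0_has_sup x).2); exists n. Qed.

Lemma c0_norm_le x (M : R) : (forall n, rnorm (x n) <= M) -> c0_norm x <= M.
Proof.
by move=> xM; apply: ge_sup; [exact: (c0_has_sup x).1|move=> _ [n _ <-]].
Qed.

Lemma c0_norm_ge0 x : 0 <= c0_norm x.
Proof. by rewrite (le_trans _ (c0_norm_ge x 0))// rnorm_ge0. Qed.

Let c0_normD x y : (c0_norm (x + y))%:C <= (c0_norm x)%:C + (c0_norm y)%:C.
Proof.
rewrite -rmorphD/= lecR; apply: c0_norm_le => n.
by rewrite (le_trans (rnormD _ _))// lerD// c0_norm_ge.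
Qed.

Let c0_normZ (k : R[i]) x : (c0_norm (k *: x))%:C = `|k| * (c0_norm x)%:C.
Proof.
have le (l : R[i]) z : c0_norm (l *: z) <= rnorm (l : R[i]^o) * c0_norm z.
  by apply: c0_norm_le => n; rewrite rnormZ ler_wpM2l ?rnorm_ge0 ?c0_norm_ge.
rewrite -[`|k|](@rnormE R (R[i]^o)) -rmorphM/=; congr (_%:C).
apply/eqP; rewrite eq_le le/=.
have [->|k0] := eqVneq k 0.
  by rewrite [X in X * _](@rnorm0 R (R[i]^o)) mul0r c0_norm_ge0.
have nk0 : 0 < rnorm (k : R[i]^o).
  rewrite lt0r rnorm_ge0 andbT; apply: contra k0 => /eqP.
  by move/(@rnorm0_eq0 R (R[i]^o))/eqP.
rewrite mulrC -ler_pdivlMr//; apply: c0_norm_le => n.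
by rewrite ler_pdivlMr// mulrC -rnormZ; exact: (c0_norm_ge (k *: x)).
Qed.

Let c0_norm_eq0 x : (c0_norm x)%:C = 0 -> x = 0.
Proof.
move=> [x0]; apply/c0_eqP => n; apply/rnorm0_eq0/eqP.
by rewrite eq_le rnorm_ge0 andbT -x0 c0_norm_ge.
Qed.

HB.instance Definition _ :=
  @Lmodule_isNormed.Build R[i] c0 (fun x => (c0_norm x)%:C)
    c0_normD c0_normZ c0_norm_eq0.

Lemma rnorm_c0E x : rnorm x = c0_norm x.
Proof. by []. Qed.

Let c0_complete (F : set_system c0) : ProperFilter F -> cauchy F -> cvg F.
Proof.
move=> FF cF.
have [|l lF] := coordinatewise_limit (c := c0_seq) _ c0_norm_ge FF cF.
  by [].
have near_l (e : R) y0 : F [set y | rnorm (y0 - y) < e] ->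
    forall n, rnorm (l n - y0 n) <= e.
  move=> Fy0 n; apply/ler_addgt0Pr => d d0.
  have [y [y0y ly]] := filter_ex (filterI Fy0 (lF n _ d0)).
  rewrite -(subrK (y n) (l n)) -addrA addrC (le_trans (rnormD _ _))// lerD//.
  rewrite rnormB (le_trans _ (ltW y0y))//.
  exact: (c0_norm_ge (y0 - y)).
have lc0 : l \in c0_pred.
  apply/asboolP/cvgrPdist_le => e /complex_gt0P[r r0 ->].
  have r2 : 0 < r / 2 by rewrite divr_gt0.
  have [y0 Fy0] := cauchy_rnorm FF cF r2.
  have r2' : 0 < (r / 2)%:C by rewrite ltcR.
  have /cvgrPdist_le/(_ _ r2') := @c0_cvg y0; apply: filterS => n.
  rewrite /= !sub0r !normrN !rnormE !lecR => yn.
  rewrite -(subrK (y0 n) (l n)) (le_trans (rnormD _ _))// [leRHS]splitr.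
  by rewrite lerD// near_l.
apply/cvg_ex; exists (C0 lc0); apply: cvg_rnorm => e e0.
have e2 : 0 < e / 2 by rewrite divr_gt0.
have [y0 Fy0] := cauchy_rnorm FF cF e2.
apply: filterS (Fy0) => y /= y0y; rewrite -(subrK y0 (C0 lc0)) -addrA.
rewrite (le_trans (rnormD _ _))// [leRHS]splitr lerD ?(ltW y0y)//.
by rewrite rnorm_c0E; apply: c0_norm_le => n; exact: near_l.
Qed.

HB.instance Definition _ := Uniform_isComplete.Build c0 c0_complete.

Let c0_mul_subproof x y : (fun n => x n * y n : R[i]^o) \in c0_pred.
Proof.
apply/asboolP; rewrite -[X in _ --> X](mulr0 (0 : R[i]^o)).
by apply: cvgM; exact: c0_cvg.
Qed.

Definition c0_mul x y : c0 := C0 (c0_mul_subproof x y).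

Let c0_mulA : associative c0_mul.
Proof. by move=> x y z; apply/c0_eqP => n /=; rewrite mulrA. Qed.
Let c0_mulDl : left_distributive c0_mul +%R.
Proof. by move=> x y z; apply/c0_eqP => n /=; rewrite -mulrDl. Qed.
Let c0_mulDr : right_distributive c0_mul +%R.
Proof. by move=> x y z; apply/c0_eqP => n /=; rewrite -mulrDr. Qed.
Let c0_mulZl (k : R[i]) x y : c0_mul (k *: x) y = k *: c0_mul x y.
Proof. by apply/c0_eqP => n; exact: (esym (mulrA k (x n) (y n))). Qed.
Let c0_mulZr (k : R[i]) x y : c0_mul x (k *: y) = k *: c0_mul x y.
Proof. by apply/c0_eqP => n; exact: (mulrCA (x n) k (y n)). Qed.
Let c0_norm_mul x y : `|c0_mul x y| <= `|x| * `|y|.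
Proof.
rewrite !rnormE -rmorphM/= lecR !rnorm_c0E; apply: c0_norm_le => n /=.
by rewrite rnormM ler_pM ?rnorm_ge0// c0_norm_ge.
Qed.

HB.instance Definition _ :=
  NormedModule_isNormedAlgebra.Build R[i] c0 c0_mulA c0_mulDl c0_mulDr
    c0_mulZl c0_mulZr c0_norm_mul.

End C0.

Section Ell1.
Variable R : realType.

Definition abs_series (x : nat -> R[i]^o) : nat -> R :=
  series (fun n => rnorm (x n)).

Definition ell1_pred : {pred nat -> R[i]^o} :=
  [pred x | `[< cvgn (abs_series x) >]].

Let abs_series_nd (x : nat -> R[i]^o) : nondecreasing_seq (abs_series x).
Proof. by apply: nondecreasing_series => n _ _; exact: rnorm_ge0. Qed.

Lemma ell1_predP (x : nat -> R[i]^o) :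
  x \in ell1_pred <-> exists M, forall n, abs_series x n <= M.
Proof.
split=> [/asboolP xcv|[M xM]].
  exists (limn (abs_series x)) => n; exact: nondecreasing_cvgn_le.
apply/asboolP/nondecreasing_is_cvgn => //.
by exists M => _ [n _ <-].
Qed.

Lemma abs_seriesD (x y : nat -> R[i]^o) n :
  abs_series (x + y) n <= abs_series x n + abs_series y n.
Proof. by rewrite -big_split/=; apply: ler_sum => i _; exact: rnormD. Qed.

Lemma abs_seriesZ (k : R[i]) (x : nat -> R[i]^o) n :
  abs_series (k *: x) n = rnorm (k : R[i]^o) * abs_series x n.
Proof. by rewrite mulr_sumr; apply: eq_bigr => i _; exact: rnormZ. Qed.

Lemma ell1_submod_closed : submod_closed ell1_pred.
Proof.
split.
  apply/ell1_predP; exists 0 => n; rewrite /abs_series/series/=.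
  by rewrite big1// => i _; exact: rnorm0.
move=> k x y /ell1_predP[M xM] /ell1_predP[N yN]; apply/ell1_predP.
exists (rnorm (k : R[i]^o) * M + N) => n; rewrite (le_trans (abs_seriesD _ _ _))//.
by rewrite abs_seriesZ lerD// ler_wpM2l ?rnorm_ge0.
Qed.

HB.instance Definition _ :=
  GRing.isSubmodClosed.Build _ _ ell1_pred ell1_submod_closed.

Record ell1 := Ell1 { ell1_seq :> nat -> R[i]^o ; _ : ell1_seq \in ell1_pred }.

HB.instance Definition _ := [isSub of ell1 for ell1_seq].
HB.instance Definition _ := [Choice of ell1 by <:].
HB.instance Definition _ := [SubChoice_isSubLmodule of ell1 by <:].

Implicit Types x y z : ell1.

Lemma ell1_eqP x y : (forall n, x n = y n) -> x = y.
Proof. by move=> xy; exact/val_inj/funext. Qed.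

Definition ell1_norm x : R := limn (abs_series x).

Let abs_series_cvg x : cvgn (abs_series x).
Proof. by case: x => x /= /asboolP. Qed.

Lemma ell1_norm_ge x n : abs_series x n <= ell1_norm x.
Proof. exact: nondecreasing_cvgn_le. Qed.

Lemma ell1_norm_le x (M : R) : (forall n, abs_series x n <= M) -> ell1_norm x <= M.
Proof. by move=> xM; apply: limr_le => //; exact: nearW. Qed.

Lemma ell1_norm_coord x n : rnorm (x n) <= ell1_norm x.
Proof.
apply: le_trans (ell1_norm_ge x n.+1).
rewrite /abs_series/series/= big_nat_recr//= lerDr sumr_ge0// => i _.
exact: rnorm_ge0.
Qed.

Lemma ell1_norm_ge0 x : 0 <= ell1_norm x.
Proof. by rewrite (le_trans _ (ell1_norm_coord x 0))// rnorm_ge0. Qed.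

Let ell1_normD x y :
  (ell1_norm (x + y))%:C <= (ell1_norm x)%:C + (ell1_norm y)%:C.
Proof.
rewrite -rmorphD/= lecR; apply: ell1_norm_le => n.
by rewrite (le_trans (abs_seriesD _ _ _))// lerD// ell1_norm_ge.
Qed.

Let ell1_normZ (k : R[i]) x : (ell1_norm (k *: x))%:C = `|k| * (ell1_norm x)%:C.
Proof.
rewrite -[`|k|](@rnormE R (R[i]^o)) -rmorphM/=; congr (_%:C).
rewrite /ell1_norm (_ : abs_series (k *: x) =
    (fun n => rnorm (k : R[i]^o) * abs_series x n)); last first.
  by apply/funext => n; exact: abs_seriesZ.
by apply/cvg_lim => //; apply: cvgMr; exact: abs_series_cvg.
Qed.

Let ell1_norm_eq0 x : (ell1_norm x)%:C = 0 -> x = 0.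
Proof.
move=> [x0]; apply/ell1_eqP => n; apply/rnorm0_eq0/eqP.
by rewrite eq_le rnorm_ge0 andbT -x0 ell1_norm_coord.
Qed.

HB.instance Definition _ :=
  @Lmodule_isNormed.Build R[i] ell1 (fun x => (ell1_norm x)%:C)
    ell1_normD ell1_normZ ell1_norm_eq0.

Lemma rnorm_ell1E x : rnorm x = ell1_norm x.
Proof. by []. Qed.

Let ell1_complete (F : set_system ell1) : ProperFilter F -> cauchy F -> cvg F.
Proof.
move=> FF cF.
have [|l lF] := coordinatewise_limit (c := ell1_seq) _ ell1_norm_coord FF cF.
  by [].
have lFn n (e : R) : 0 < e ->
    F [set y | abs_series (l - ell1_seq y) n <= e].
  elim: n e => [|n IH] e e0.
    by apply: nearW => y; rewrite /= /abs_series/series/= big_geq// ltW.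
  have e2 : 0 < e / 2 by rewrite divr_gt0.
  apply: filterS2 (IH _ e2) (lF n _ e2) => y /= yn ly.
  rewrite /abs_series/series/= big_nat_recr//= [leRHS]splitr.
  exact: lerD.
have near_l (e : R) y0 : F [set y | rnorm (y0 - y) < e] ->
    forall n, abs_series (l - ell1_seq y0) n <= e.
  move=> Fy0 n; apply/ler_addgt0Pr => d d0.
  have [y [y0y ly]] := filter_ex (filterI Fy0 (lFn n _ d0)).
  rewrite (_ : _ - _ = (l - ell1_seq y) + ell1_seq (y - y0)); last first.
    by rewrite /= addrA subrK.
  rewrite (le_trans (abs_seriesD _ _ _))// addrC lerD//.
  by rewrite (le_trans (ell1_norm_ge _ _))// -rnorm_ell1E rnormB ltW.
have [y1 Fy1] := cauchy_rnorm FF cF (@ltr01 R).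
have l1 : l \in ell1_pred.
  apply/ell1_predP; exists (1 + ell1_norm y1) => n.
  rewrite -(subrK (ell1_seq y1) l) (le_trans (abs_seriesD _ _ _))//.
  by rewrite lerD ?ell1_norm_ge// near_l.
apply/cvg_ex; exists (Ell1 l1); apply: cvg_rnorm => e e0.
have e2 : 0 < e / 2 by rewrite divr_gt0.
have [y0 Fy0] := cauchy_rnorm FF cF e2.
apply: filterS (Fy0) => y /= y0y; rewrite -(subrK y0 (Ell1 l1)) -addrA.
rewrite (le_trans (rnormD _ _))// [leRHS]splitr lerD ?(ltW y0y)//.
by rewrite rnorm_ell1E; apply: ell1_norm_le => n; exact: near_l.
Qed.

HB.instance Definition _ := Uniform_isComplete.Build ell1 ell1_complete.

End Ell1.

Section DualActions.
Variable R : realType.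
Implicit Types (x y : ell1 R) (phi psi : c0 R).

Lemma abs_series_act x phi n :
  abs_series (fun n => x n * phi n : R[i]^o) n <= rnorm phi * abs_series x n.
Proof.
rewrite mulr_sumr; apply: ler_sum => i _.
by rewrite rnormM mulrC ler_wpM2r ?rnorm_ge0// rnorm_c0E c0_norm_ge.
Qed.

Let ell1_act_subproof x phi :
  (fun n => x n * phi n : R[i]^o) \in @ell1_pred R.
Proof.
apply/ell1_predP; exists (rnorm phi * ell1_norm x) => n.
rewrite (le_trans (abs_series_act _ _ _))// ler_wpM2l ?rnorm_ge0//.
exact: ell1_norm_ge.
Qed.

Definition ell1_actr x phi : ell1 R := Ell1 (ell1_act_subproof x phi).

Definition ell1_actl phi x : ell1 R := Ell1 (ell1_act_subproof x phi).

Lemma ell1_act_norm x phi : rnorm (ell1_actr x phi) <= rnorm x * rnorm phi.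
Proof.
rewrite rnorm_ell1E; apply: ell1_norm_le => n.
rewrite mulrC (le_trans (abs_series_act _ _ _))// ler_wpM2l ?rnorm_ge0//.
exact: ell1_norm_ge.
Qed.

(* The duality identifying [l_1] with the dual of [c_0]. The next two lemmas
   show that [ell1_actr] and [ell1_actl], both the pointwise product, are the
   right and left dual module actions. *)
Definition ell1_pairing x phi : R[i]^o :=
  limn (series (fun n => x n * phi n : R[i]^o)).

Lemma ell1_actrP x phi psi :
  ell1_pairing (ell1_actr x phi) psi = ell1_pairing x (phi ** psi).
Proof. by rewrite /ell1_pairing; under eq_fun do rewrite /= -mulrA. Qed.

Lemma ell1_actlP x phi psi :
  ell1_pairing (ell1_actl phi x) psi = ell1_pairing x (psi ** phi).
Proof.
by rewrite /ell1_pairing; under eq_fun do rewrite /= -mulrA [phi _ * _]mulrC.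
Qed.

End DualActions.

Definition l1sum (U V : Type) : Type := (U * V)%type.

Section L1Sum.
Context {R : realType} (U V : completeNormedModType R[i]).
Local Notation W := (l1sum U V).

HB.instance Definition _ := GRing.Lmodule.copy W (U * V)%type.

Implicit Types w z : W.

Let l1sum_norm w : R[i] := `|w.1| + `|w.2|.

Let l1sum_normD w z : l1sum_norm (w + z) <= l1sum_norm w + l1sum_norm z.
Proof. by rewrite /l1sum_norm addrACA lerD// ler_normD. Qed.

Let l1sum_normZ (k : R[i]) w : l1sum_norm (k *: w) = `|k| * l1sum_norm w.
Proof. by rewrite /l1sum_norm mulrDr -!normrZ. Qed.

Let l1sum_norm_eq0 w : l1sum_norm w = 0 -> w = 0.
Proof.
case: w => u v; rewrite /l1sum_norm/= => /eqP.
by rewrite paddr_eq0// !normr_eq0 => /andP[/eqP-> /eqP->].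
Qed.

HB.instance Definition _ := @Lmodule_isNormed.Build R[i] W
  (fun w => `|w.1| + `|w.2|) l1sum_normD l1sum_normZ l1sum_norm_eq0.

Lemma rnorm_l1sumE w : rnorm w = rnorm w.1 + rnorm w.2.
Proof. by apply: complexI; rewrite rmorphD/= -!rnormE. Qed.

Let l1sum_complete (F : set_system W) : ProperFilter F -> cauchy F -> cvg F.
Proof.
move=> FF cF.
have c1 : cauchy ((fst : W -> U) @ F).
  apply/cauchyP => e /complex_gt0P[r r0 ->].
  have [x Fx] := cauchy_rnorm FF cF r0; exists x.1.
  rewrite /nbhs/= /fmap/=; apply: filterS Fx => y /= xy.
  rewrite -ball_normE/= rnormE ltcR (le_lt_trans _ xy)// rnorm_l1sumE.
  by rewrite lerDl rnorm_ge0.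
have c2 : cauchy ((snd : W -> V) @ F).
  apply/cauchyP => e /complex_gt0P[r r0 ->].
  have [x Fx] := cauchy_rnorm FF cF r0; exists x.2.
  rewrite /nbhs/= /fmap/=; apply: filterS Fx => y /= xy.
  rewrite -ball_normE/= rnormE ltcR (le_lt_trans _ xy)// rnorm_l1sumE.
  by rewrite lerDr rnorm_ge0.
have /cvg_ex[/= u uF] : cvg ((fst : W -> U) @ F) by exact: cauchy_cvg.
have /cvg_ex[/= v vF] : cvg ((snd : W -> V) @ F) by exact: cauchy_cvg.
apply/cvg_ex; exists ((u, v) : W); apply: cvg_rnorm => e e0.
have e2 : 0 < e / 2 by rewrite divr_gt0.
have Fu2 : F [set w : W | rnorm (u - w.1) <= e / 2] by exact: (cvg_rnormP _ uF e2).
have Fv2 : F [set w : W | rnorm (v - w.2) <= e / 2] by exact: (cvg_rnormP _ vF e2).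
apply: filterS2 Fu2 Fv2 => -[a b] /= ua vb.
by rewrite rnorm_l1sumE/= [leRHS]splitr lerD.
Qed.

HB.instance Definition _ := Uniform_isComplete.Build W l1sum_complete.

End L1Sum.

Section Ell1C0.
Variable R : realType.

Definition ell1_c0 : Type := l1sum (ell1 R) (c0 R).

HB.instance Definition _ := CompleteNormedModule.copy ell1_c0
  (l1sum (ell1 R) (c0 R)).

Implicit Types u v w : ell1_c0.

(* (x, phi) (y, psi) = (x psi + phi y, phi psi) *)
Definition ell1_c0_mul u v : ell1_c0 :=
  let: (x, phi) := u in let: (y, psi) := v in
  (ell1_actr x psi + ell1_actl phi y, phi ** psi).

Let mulA : associative ell1_c0_mul.
Proof.
move=> [x a] [y b] [z c]; congr pair; last exact: amulA.
by apply/ell1_eqP => n /=; rewrite !fctE /=; ring.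
Qed.

Let mulDl : left_distributive ell1_c0_mul +%R.
Proof.
move=> [x a] [y b] [z c]; congr pair; last exact: amulDl.
by apply/ell1_eqP => n /=; rewrite !fctE /=; ring.
Qed.

Let mulDr : right_distributive ell1_c0_mul +%R.
Proof.
move=> [x a] [y b] [z c]; congr pair; last exact: amulDr.
by apply/ell1_eqP => n /=; rewrite !fctE /=; ring.
Qed.

Let mulZl (k : R[i]) u v : ell1_c0_mul (k *: u) v = k *: ell1_c0_mul u v.
Proof.
case: u v => [x a] [y b]; congr pair; last exact: amulZl.
by apply/ell1_eqP => n /=; rewrite !fctE /= /GRing.scale/=; ring.
Qed.

Let mulZr (k : R[i]) u v : ell1_c0_mul u (k *: v) = k *: ell1_c0_mul u v.
Proof.
case: u v => [x a] [y b]; congr pair; last exact: amulZr.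
by apply/ell1_eqP => n /=; rewrite !fctE /= /GRing.scale/=; ring.
Qed.

Let norm_mul u v : `|ell1_c0_mul u v| <= `|u| * `|v|.
Proof.
case: u v => [x a] [y b]; rewrite !rnormE -rmorphM/= lecR !rnorm_l1sumE/=.
rewrite (le_trans (lerD (rnormD _ _) (rnorm_amul _ _)))//.
have xb := ell1_act_norm x b; have ya := ell1_act_norm y a.
rewrite (le_trans (lerD (lerD xb ya) (lexx _)))//.
rewrite [leRHS](_ : _ = rnorm x * rnorm y +
  (rnorm x * rnorm b + rnorm y * rnorm a + rnorm a * rnorm b)); last by ring.
by rewrite lerDr mulr_ge0// rnorm_ge0.
Qed.

HB.instance Definition _ :=
  NormedModule_isNormedAlgebra.Build R[i] ell1_c0 mulA mulDl mulDr
    mulZl mulZr norm_mul.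

End Ell1C0.

(* Main.v *)
Require Import Defs.
From mathcomp Require Import all_boot all_order all_algebra.
From mathcomp Require Import complex.
From mathcomp Require Import all_classical all_reals.
From mathcomp Require Import topology normedtype sequences.

(** The algebra is commutative: both coordinates of a product are sums of
pointwise products of sequences. Write u_n = (e_n, 0) and v_n = (0, e_n) for
the unit vectors. Three facts carry the proof.

The partial sums s_k = v_0 + ... + v_(k-1) have norm at most 1, and s_k a is
the truncation of a, so s_k a -> a: this is the contractive approximate
identity, and every functional f satisfies
   f (x, phi) = sum_n (x_n f(u_n) + phi_n f(v_n))        ([dual_expansion]).

A functional is absolutely summable along a sequence all of whose combinations
with coefficients in the unit disc are bounded ([dual_summable]). With the v_n
this makes (f(s_k))_k a Cauchy sequence for each f, while a weak limit of the
s_k would have second component constantly 1, which is not in c_0. So weak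
sequential completeness fails, and standardness with it. With the coordinate
functionals u'_n of l_1, seen in the dual of the algebra, it makes the values
m(u'_n) summable for each m in the bidual. With v'_n the coordinate functionals
of c_0, multiplying (x, phi) by m gives the element with components
x_n m(v'_n) + phi_n m(u'_n) and phi_n m(v'_n), as the expansion formula shows;
hence the algebra is an ideal in its bidual.

Arens regularity is decided by iterated limits. Taking M and N in the bidual to
be limits along a free ultrafilter of the u_k and of the s_j, and f a
functional with f(u_n) = 1 for all n, one gets f(u_k s_j) = 1 if k < j and 0
otherwise, so the two Arens products of M and N take the values 1 and 0 at f
([arens_regular_iterated_limits]). On the other hand the closed ideal l_1 has
zero product, and the quotient is a copy of c_0, whose dual is the closed span
of the coordinate characters; both Arens products are determined by their
values m(chi) n(chi) at characters chi ([arens_regular_dense_characters]). *)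

Set Implicit Arguments.
Unset Strict Implicit.
Unset Printing Implicit Defensive.

Import Order.TTheory GRing.Theory Num.Theory.
Import numFieldNormedType.Exports.

Local Open Scope classical_set_scope.
Local Open Scope ring_scope.
Local Open Scope complex_scope.

(** * Functionals *)

Lemma rnorm_le_eq0 (R : realType) (V : normedModType R[i]) (x : V) :
  (forall e : R, 0 < e -> rnorm x <= e) -> x = 0.
Proof.
move=> x0; apply/rnorm0_eq0/eqP; rewrite eq_le rnorm_ge0 andbT.
by apply/ler_addgt0Pr => e /x0; rewrite add0r.
Qed.

Lemma rnorm_sum (R : realType) (V : normedModType R[i]) (v : nat -> V) m n :
  rnorm (\sum_(m <= i < n) v i) <= \sum_(m <= i < n) rnorm (v i).
Proof.
elim/big_ind2 : _ => [|x a y b xa yb|//]; first by rewrite rnorm0.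
by rewrite (le_trans (rnormD _ _))// lerD.
Qed.

Lemma rnorm_real (R : realType) (r : R) : 0 <= r -> rnorm (r%:C : R[i]^o) = r.
Proof. by move=> r0; rewrite /rnorm ger0_norm// ler0c. Qed.

Lemma rnorm1 (R : realType) : rnorm (1 : R[i]^o) = 1.
Proof. by rewrite /rnorm normr1. Qed.

Lemma dual_sumE (R : realType) (V : normedModType R[i]) (f : nat -> dual V) m n x :
  (\sum_(m <= i < n) f i) x = \sum_(m <= i < n) f i x.
Proof. by elim/big_rec2 : _ => // i a g _ <-. Qed.

Lemma cvg_dual (R : realType) (V : normedModType R[i]) (I : Type) (F : set_system I)
    {FF : Filter F} (u : I -> V) (x : V) (f : dual V) :
  u i @[i --> F] --> x -> (f (u i) : R[i]^o) @[i --> F] --> f x.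
Proof. by move=> ux; apply: cvg_comp ux _; exact: dual_continuous. Qed.

Lemma cvg_normed_unique (R : realType) (V : normedModType R[i]) (I : Type) (F : set_system I)
    {FF : ProperFilter F} (u : I -> V) (x y : V) :
  u i @[i --> F] --> x -> u i @[i --> F] --> y -> x = y.
Proof. by apply: cvg_unique; exact: norm_hausdorff. Qed.

Lemma cvg_rnorm_le (R : realType) (V : normedModType R[i]) (I : Type) (F : set_system I)
    {FF : ProperFilter F} (u : I -> V) (x : V) (M : R) :
  (forall i, rnorm (u i) <= M) -> u i @[i --> F] --> x -> rnorm x <= M.
Proof.
move=> uM ux; apply/ler_addgt0Pr => e e0.
have Fx : F [set i | rnorm (x - u i) <= e] by exact: (cvg_rnormP _ ux e0).
have [i /= xi] := filter_ex Fx.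
by rewrite -(subrK (u i) x) (le_trans (rnormD _ _))// addrC lerD.
Qed.

(** The adjoint of a bounded linear map [h]. *)
Definition dual_pull (R : realType) (V W : normedModType R[i]) (h : V -> W)
    (lh : linear h) (M : R) (hM : forall x, rnorm (h x) <= M * rnorm x)
    (f : dual W) : dual V.
Proof.
apply: (@mk_dual _ _ (fun x => f (h x))).
  by move=> k x y; rewrite lh linearP.
exists (rnorm f * M) => x; rewrite (le_trans (dual_rnorm_le _ _))//.
by rewrite -mulrA ler_wpM2l// rnorm_ge0.
Defined.

Lemma bidual_embedE (R : realType) (V : normedModType R[i]) (x : V) (f : dual V) :
  bidual_embed x f = f x.
Proof. by []. Qed.

Lemma dual_actE (R : realType) (A : normedAlgType R[i]) (f : dual A) (a b : A) :
  (dual_actr f a b = f (a ** b)) * (dual_actl a f b = f (b ** a)).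
Proof. by []. Qed.

Lemma bidual_actE (R : realType) (A : normedAlgType R[i]) (m : dual (dual A))
    (f : dual A) (a : A) :
  (bidual_actl m f a = m (dual_actr f a)) * (bidual_actr f m a = m (dual_actl a f)).
Proof. by []. Qed.

Lemma arensE (R : realType) (A : normedAlgType R[i]) (m n : dual (dual A))
    (f : dual A) :
  (arens1 m n f = m (bidual_actl n f)) * (arens2 m n f = n (bidual_actr f m)).
Proof. by []. Qed.

Lemma phaseP (R : realType) (z : R[i]^o) :
  exists2 t : R[i]^o, rnorm t <= 1 & t * z = (rnorm z)%:C.
Proof.
have [->|z0] := eqVneq z 0.
  by exists 0; rewrite ?rnorm0 ?ler01// mulr0.
have nz0 : rnorm z != 0 by apply: contra z0 => /eqP/rnorm0_eq0/eqP.
exists ((rnorm z)%:C / z); last by rewrite divfK.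
rewrite rnormM rnorm_real ?rnorm_ge0//.
have := rnormM z z^-1; rewrite divff// rnorm1 => <-//.
Qed.

(** Rotating each vector [v n] by a suitable phase makes every [f (v n)]
nonnegative, so the sum of their moduli is one value of [f]. *)
Lemma dual_summable (R : realType) (V : normedModType R[i]) (v : nat -> V) (M : R)
    (f : dual V) N :
  (forall t : nat -> R[i]^o, (forall n, rnorm (t n) <= 1) ->
     rnorm (\sum_(0 <= n < N) (t n : R[i]) *: v n) <= M) ->
  \sum_(0 <= n < N) rnorm (f (v n)) <= rnorm f * M.
Proof.
move=> vM.
have /choice[t tP] : forall n, exists t : R[i]^o,
    rnorm t <= 1 /\ t * f (v n) = (rnorm (f (v n)))%:C.
  by move=> n; have [t ? ?] := phaseP (f (v n)); exists t.
have := dual_rnorm_le f (\sum_(0 <= n < N) (t n : R[i]) *: v n).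
rewrite linear_sum/=.
under eq_bigr do rewrite linearZ/= [_ *: _](tP _).2.
rewrite -rmorph_sum/= rnorm_real; last by apply: sumr_ge0 => i _; exact: rnorm_ge0.
move/le_trans; apply; rewrite ler_wpM2l ?rnorm_ge0//; apply: vM => n.
exact: (tP n).1.
Qed.

(** * Ultralimits *)

(** If the preimage of a set [A] is not in [U], that of its complement is; so no
proper filter containing the image of [U] contains [A]. *)
Lemma ultra_fmap (I T : Type) (q : I -> T) (U : set_system I) :
  UltraFilter U -> UltraFilter (fmap q U).
Proof.
move=> UU; split=> [|G GF UG]; first exact: fmap_proper_filter.
rewrite eqEsubset; split=> // A GA.
have [//|UnA] := in_ultra_setVsetC (q @^-1` A) UU.
by have [x []] := filter_ex (filterI GA (UG (~` A) UnA)).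
Qed.

(** Real and imaginary parts live in compact intervals, where ultrafilters
converge. *)
Lemma bounded_ultra_cvg (R : realType) (I : Type) (U : set_system I) (p : I -> R[i]^o)
    (M : R) : UltraFilter U ->
  (forall i, rnorm (p i) <= M) -> exists z : R[i]^o, p i @[i --> U] --> z.
Proof.
move=> UU pM.
have part (q : I -> R) : (forall i, `|q i| <= M) -> exists a : R, q i @[i --> U] --> a.
  move=> qM; have := @segment_compact R (- M) M; rewrite compact_ultra.
  move=> /(_ (q @ U) (ultra_fmap _ UU)) seg.
  have [|a [_ qa]] := seg; last by exists a.
  by apply: (@filterS _ U _ setT) filterT => i _; rewrite /= in_itv/= -ler_norml.
have [|a qa] := part (fun i => complex.Re (p i)).
  by move=> i; rewrite (le_trans (rnorm_Re _)).
have [|b qb] := part (fun i => complex.Im (p i)).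
  by move=> i; rewrite (le_trans (rnorm_Im _)).
exists (a +i* b); apply: cvg_rnorm => e e0.
have e2 : 0 < e / 2 by rewrite divr_gt0.
have ae : U [set i | `|a - complex.Re (p i)| <= e / 2].
  by move/cvgrPdist_le : qa => /(_ _ e2).
have be : U [set i | `|b - complex.Im (p i)| <= e / 2].
  by move/cvgrPdist_le : qb => /(_ _ e2).
rewrite /nbhs/= /fmap/=; apply: filterS2 ae be => i /=.
case: (p i) => c d /= ac bd.
by rewrite (le_trans (rnorm_ReIm _))//= [leRHS]splitr lerD.
Qed.

(** The Banach-Alaoglu theorem along an ultrafilter: the pointwise limits of a
bounded family of functionals form a bounded functional. *)
Lemma dual_ultralimit (R : realType) (V : normedModType R[i]) (I : Type)
    (U : set_system I) (p : I -> dual V) (M : R) : UltraFilter U ->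
  (forall i, rnorm (p i) <= M) ->
  exists q : dual V, forall x, (p i x : R[i]^o) @[i --> U] --> q x.
Proof.
move=> UU pM.
have pxM x i : rnorm (p i x) <= M * rnorm x.
  by rewrite (le_trans (dual_rnorm_le _ _))// ler_wpM2r ?rnorm_ge0.
have /choice[q qP] : forall x, exists z : R[i]^o, (p i x : R[i]^o) @[i --> U] --> z.
  by move=> x; exact: bounded_ultra_cvg (pxM x).
have lq : linear q.
  move=> k x y; apply: cvg_normed_unique (qP _) _.
  rewrite (_ : (fun i => _) = (fun i => k *: p i x + p i y)); last first.
    by apply/funext => i; rewrite linearP.
  by apply: cvgD; [apply: cvgZr; exact: qP|exact: qP].
have bq : exists M : R, forall x, rnorm (q x) <= M * rnorm x.
  by exists M => x; exact: cvg_rnorm_le (pxM x) (qP x).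
by exists (mk_dual lq bq) => x; exact: qP.
Qed.

(** * Arens regularity *)

(** Unfolding [arens_regular] exposes local definitions in front of the
quantifiers; this form can be used directly. *)
Lemma arens_regularE (R : realType) (A : normedAlgType R[i]) :
  arens_regular A <-> forall m n : dual (dual A), arens1 m n = arens2 m n.
Proof. by []. Qed.

(** In the bidual, let m and n be the ultralimits of [u] and [v]. The first Arens
product evaluated at [f] takes the limit over [v] first, the second takes the
limit over [u] first. *)
Lemma arens_regular_iterated_limits (R : realType) (A : normedAlgType R[i])
    (U : set_system nat) (u v : nat -> A) (M : R) (f : dual A)
    (a b : nat -> R[i]^o) (l r : R[i]^o) : UltraFilter U ->
  (forall k, rnorm (u k) <= M) -> (forall k, rnorm (v k) <= M) ->
  (forall k, (f (u k ** v j) : R[i]^o) @[j --> U] --> a k) -> a k @[k --> U] --> l ->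
  (forall j, (f (u k ** v j) : R[i]^o) @[k --> U] --> b j) -> b j @[j --> U] --> r ->
  arens_regular A -> l = r.
Proof.
move=> UU uM vM fa al fb br /arens_regularE reg.
have embM (w : nat -> A) : (forall k, rnorm (w k) <= M) ->
    forall k, rnorm (bidual_embed (w k)) <= M.
  move=> wM k; rewrite rnorm_dualE; apply: opnorm_le => g g1.
  rewrite bidual_embedE (le_trans (dual_rnorm_le _ _))// -[leRHS]mul1r.
  by rewrite ler_pM ?rnorm_ge0.
have [m mP] := dual_ultralimit UU (embM _ uM).
have [n nP] := dual_ultralimit UU (embM _ vM).
have nu k : bidual_actl n f (u k) = a k.
  apply: (@cvg_normed_unique R R[i]^o _ U _ (fun j => f (u k ** v j))) (fa k).
  exact: (nP (dual_actr f (u k))).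
have mv j : bidual_actr f m (v j) = b j.
  apply: (@cvg_normed_unique R R[i]^o _ U _ (fun k => f (u k ** v j))) (fb j).
  exact: (mP (dual_actl (v j) f)).
have am : a k @[k --> U] --> (m (bidual_actl n f) : R[i]^o).
  have -> : a = (fun k => bidual_embed (u k) (bidual_actl n f)).
    by apply/funext => k; rewrite -nu.
  exact: mP.
have bn : b j @[j --> U] --> (n (bidual_actr f m) : R[i]^o).
  have -> : b = (fun j => bidual_embed (v j) (bidual_actr f m)).
    by apply/funext => j; rewrite -mv.
  exact: nP.
have mn1 : l = arens1 m n f by exact: (@cvg_normed_unique R R[i]^o _ U _ _ _ _ al am).
have mn2 : r = arens2 m n f by exact: (@cvg_normed_unique R R[i]^o _ U _ _ _ _ br bn).
by rewrite mn1 mn2 (reg m n).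
Qed.

(** A character chi satisfies chi . a = a . chi = chi(a) chi, so at chi both Arens
products of m and n equal m(chi) n(chi). Two elements of the bidual that agree on
a set with dense span are equal. *)
Lemma arens_regular_dense_characters (R : realType) (A : normedAlgType R[i])
    (chi : nat -> dual A) :
  (forall n a b, chi n (a ** b) = chi n a * chi n b) ->
  (forall (f : dual A) (e : R), 0 < e -> exists K (c : nat -> R[i]),
     rnorm (f - \sum_(0 <= n < K) c n *: chi n) <= e) ->
  arens_regular A.
Proof.
move=> chiM dense; apply/arens_regularE => m n; apply/dualP => f.
apply: (@subr0_eq R[i]^o).
have [D DE] : exists D : dual (dual A), forall g, D g = arens1 m n g - arens2 m n g.
  by exists (arens1 m n - arens2 m n).
rewrite -DE.
have Dchi k : D (chi k) = 0.
  have chi_act p : bidual_actl p (chi k) = p (chi k) *: chi k /\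
      bidual_actr (chi k) p = p (chi k) *: chi k.
    have actr a : dual_actr (chi k) a = chi k a *: chi k.
      by apply/dualP => b; rewrite dual_actE chiM.
    have actl a : dual_actl a (chi k) = chi k a *: chi k.
      by apply/dualP => b; rewrite dual_actE chiM mulrC.
    split; apply/dualP => a; rewrite bidual_actE ?actr ?actl linearZ/=.
      exact: mulrC.
    exact: mulrC.
  rewrite DE !arensE.
  rewrite (chi_act n).1 (chi_act m).2 !linearZ/=.
  rewrite scalerN; apply/eqP; rewrite subr_eq0; apply/eqP; exact: mulrC.
apply: rnorm_le_eq0 => e e0.
have D1 : 0 < rnorm D + 1 by rewrite ltr_wpDl// rnorm_ge0.
have [K [c fK]] := dense f (e / (rnorm D + 1)) (divr_gt0 e0 D1).
have Dc : D (\sum_(0 <= n < K) c n *: chi n) = 0.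
  by rewrite linear_sum/= big1// => i _; rewrite linearZ/= Dchi scaler0.
rewrite (_ : D f = D (f - \sum_(0 <= n < K) c n *: chi n)); last first.
  by rewrite linearB/= Dc subr0.
rewrite (le_trans (dual_rnorm_le _ _))// (le_trans (ler_wpM2l (rnorm_ge0 _) fK))//.
by rewrite mulrCA ler_piMr ?(ltW e0)// ler_pdivrMr// mul1r lerDl.
Qed.

(** The second adjoint of the homomorphism [k] respects both Arens products. It
separates points, because the left inverse [h] makes every functional on [B]
factor through [k]. *)
Lemma arens_regular_retract (R : realType) (A B : normedAlgType R[i])
    (k : B -> A) (h : A -> B) (M N : R) (lk : linear k) (lh : linear h) :
  (forall b, rnorm (k b) <= M * rnorm b) -> (forall a, rnorm (h a) <= N * rnorm a) ->
  (forall b c, k (b ** c) = k b ** k c) -> cancel k h ->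
  arens_regular A -> arens_regular B.
Proof.
move=> kM hN kmul kK /arens_regularE reg.
apply/arens_regularE => m n; apply/dualP => g.
pose pull := dual_pull lk kM.
have pullE f b : pull f b = f (k b) by [].
have lpull : linear pull by move=> c f f'; apply/dualP.
have pullM f : rnorm (pull f) <= `|M| * rnorm f.
  rewrite rnorm_dualE; apply: opnorm_le => x x1.
  rewrite pullE (le_trans (dual_rnorm_le _ _))// mulrC.
  rewrite ler_wpM2r ?rnorm_ge0// (le_trans (kM x))//.
  rewrite (le_trans (ler_wpM2r (rnorm_ge0 x) (ler_norm M)))//.
  by rewrite ler_piMr.
pose push := dual_pull lpull pullM.
have -> : g = pull (dual_pull lh hN g).
  by apply/dualP => b; rewrite pullE -[LHS]/(g b) -[in LHS](kK b).
move: (dual_pull lh hN g) => f.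
have actr b : dual_actr (pull f) b = pull (dual_actr f (k b)).
  by apply/dualP => c; rewrite dual_actE !pullE dual_actE kmul.
have actl b : dual_actl b (pull f) = pull (dual_actl (k b) f).
  by apply/dualP => c; rewrite dual_actE !pullE dual_actE kmul.
have bactl p : bidual_actl p (pull f) = pull (bidual_actl (push p) f).
  by apply/dualP => b; rewrite pullE !bidual_actE actr.
have bactr p : bidual_actr (pull f) p = pull (bidual_actr f (push p)).
  by apply/dualP => b; rewrite pullE !bidual_actE actl.
have := congr1 (fun q : dual (dual A) => q f) (reg (push m) (push n)).
by rewrite !arensE bactl bactr.
Qed.

(** * Unit vectors of c_0 and l_1 *)

Definition unit_seq (R : realType) (n : nat) : nat -> R[i]^o :=
  fun i => (i == n)%:R.

Lemma unit_seq_c0 (R : realType) n : unit_seq R n \in @c0_pred R.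
Proof.
apply/asboolP; apply: cvg_near_cst; exists n.+1 => // i /= ni.
by rewrite /unit_seq gtn_eqF.
Qed.

Lemma abs_series_unit_seq (R : realType) n N : abs_series (unit_seq R n) N <= 1.
Proof.
rewrite /abs_series/series/= big_mkord; have [nN|Nn] := ltnP n N.
  rewrite (bigD1 (Ordinal nN))//= big1 ?addr0 /unit_seq ?eqxx ?rnorm1// => i.
  by rewrite -val_eqE/= => /negPf ->; rewrite rnorm0.
rewrite big1// => i _; rewrite /unit_seq ltn_eqF ?rnorm0//.
exact: leq_trans (ltn_ord i) Nn.
Qed.

Lemma unit_seq_ell1 (R : realType) n : unit_seq R n \in @ell1_pred R.
Proof. by apply/ell1_predP; exists 1 => N; exact: abs_series_unit_seq. Qed.

Definition c0_unit (R : realType) n : c0 R := C0 (unit_seq_c0 R n).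

Definition ell1_unit (R : realType) n : ell1 R := Ell1 (unit_seq_ell1 R n).

Lemma c0_combE (R : realType) (t : nat -> R[i]^o) N i :
  (\sum_(0 <= n < N) (t n : R[i]) *: c0_unit R n) i = if (i < N)%N then t i else 0.
Proof.
elim: N => [|N IH]; first by rewrite big_geq.
rewrite big_nat_recr//= fctE IH fctE /unit_seq [in RHS]ltnS [in RHS]leq_eqVlt.
have [->|iN] := eqVneq i N; last by rewrite scaler0 addr0.
by rewrite ltnn add0r; exact: mulr1.
Qed.

Lemma ell1_combE (R : realType) (t : nat -> R[i]^o) N i :
  (\sum_(0 <= n < N) (t n : R[i]) *: ell1_unit R n) i = if (i < N)%N then t i else 0.
Proof.
elim: N => [|N IH]; first by rewrite big_geq.
rewrite big_nat_recr//= fctE IH fctE /unit_seq [in RHS]ltnS [in RHS]leq_eqVlt.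
have [->|iN] := eqVneq i N; last by rewrite scaler0 addr0.
by rewrite ltnn add0r; exact: mulr1.
Qed.

Lemma c0_comb_norm (R : realType) (t : nat -> R[i]^o) N :
  (forall n, rnorm (t n) <= 1) ->
  rnorm (\sum_(0 <= n < N) (t n : R[i]) *: c0_unit R n) <= 1.
Proof.
move=> t1; rewrite rnorm_c0E; apply: c0_norm_le => i; rewrite c0_combE.
by case: ifP => // _; rewrite rnorm0 ler01.
Qed.

Lemma c0_expansion (R : realType) (phi : c0 R) :
  (\sum_(0 <= n < k) (phi n : R[i]) *: c0_unit R n) @[k --> \oo] --> phi.
Proof.
apply: cvg_rnorm => e e0.
have phie : \forall n \near \oo, rnorm (0 - phi n) <= e.
  exact: (cvg_rnormP _ (@c0_cvg R phi) e0).
case: phie => K _ Ke; exists K => // k /= Kk.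
rewrite rnorm_c0E; apply: c0_norm_le => i.
rewrite -[_ i]/(phi i - (\sum_(0 <= n < k) (phi n : R[i]) *: c0_unit R n) i).
rewrite c0_combE; case: ltnP => [_|ki]; first by rewrite subrr rnorm0 ltW.
by rewrite subr0 -rnormN -sub0r; exact/Ke/(leq_trans Kk).
Qed.

Lemma ell1_tail (R : realType) (x : ell1 R) (e : R) : 0 < e ->
  \forall k \near \oo, ell1_norm x - abs_series x k <= e.
Proof.
move=> e0; have xcv : cvgn (abs_series x) by case: x => x /= /asboolP.
have /cvgrPdist_le/(_ _ e0) : abs_series x @ \oo --> ell1_norm x by [].
by apply: filterS => k; apply: le_trans; exact: ler_norm.
Qed.

Lemma abs_series_tail (R : realType) (x : ell1 R) k n : (k <= n)%N ->
  \sum_(k <= i < n) rnorm (x i) <= ell1_norm x - abs_series x k.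
Proof.
move=> kn; rewrite lerBrDl (le_trans _ (ell1_norm_ge x n))//.
by rewrite /abs_series/series/= [leRHS](big_cat_nat (leq0n k) kn).
Qed.

Lemma abs_series_truncated (R : realType) (x : ell1 R) (a : nat -> R[i]^o) k n :
  (forall i, a i = if (i < k)%N then 0 else x i) ->
  \sum_(0 <= i < n) rnorm (a i) <= ell1_norm x - abs_series x k.
Proof.
move=> aE; have a0 m : (m <= k)%N -> \sum_(0 <= i < m) rnorm (a i) = 0.
  move=> mk; rewrite big_nat big1// => i /andP[_ im].
  by rewrite aE (leq_trans im mk) rnorm0.
have [nk|/ltnW kn] := leqP n k; first by rewrite a0// subr_ge0 ell1_norm_ge.
rewrite (big_cat_nat (leq0n k) kn)/= a0// add0r (le_trans _ (abs_series_tail x kn))//.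
by apply: ler_sum_nat => i /andP[ki _]; rewrite aE ltnNge ki.
Qed.

Lemma ell1_expansion (R : realType) (x : ell1 R) :
  (\sum_(0 <= n < k) (x n : R[i]) *: ell1_unit R n) @[k --> \oo] --> x.
Proof.
apply: cvg_rnorm => e e0; apply: filterS (ell1_tail x e0) => k /= xk.
rewrite rnorm_ell1E; apply: ell1_norm_le => n; rewrite (le_trans _ xk)//.
apply: abs_series_truncated => i.
rewrite -[LHS]/(x i - (\sum_(0 <= n < k) (x n : R[i]) *: ell1_unit R n) i).
by rewrite ell1_combE; case: ifP => _; rewrite ?subrr ?subr0.
Qed.

(** * The Banach algebra c_0 *)

Lemma c0_coord_linear (R : realType) n : linear (fun phi : c0 R => phi n).
Proof. by []. Qed.

Lemma c0_coord_le (R : realType) n (phi : c0 R) : rnorm (phi n) <= 1 * rnorm phi.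
Proof. by rewrite mul1r rnorm_c0E c0_norm_ge. Qed.

Definition c0_coord (R : realType) n : dual (c0 R) :=
  mk_dual (@c0_coord_linear R n) (ex_intro _ _ (@c0_coord_le R n)).

(** By continuity it is enough to evaluate [f] at the truncations of a sequence of
the unit ball, whose coefficients lie in the unit disc. *)
Lemma dual_c0_norm_le (R : realType) (f : dual (c0 R)) (M : R) :
  (forall N, \sum_(0 <= n < N) rnorm (f (c0_unit R n)) <= M) -> rnorm f <= M.
Proof.
move=> fM; rewrite rnorm_dualE; apply: opnorm_le => phi phi1.
apply: (cvg_rnorm_le _ (cvg_dual (f := f) (@c0_expansion R phi))) => N.
rewrite linear_sum/= (le_trans (rnorm_sum _ _ _))// (le_trans _ (fM N))//.
apply: ler_sum => n _; rewrite linearZ/= rnormZ ler_piMl ?rnorm_ge0//.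
by rewrite (le_trans _ phi1)// rnorm_c0E; exact: c0_norm_ge.
Qed.

Lemma dual_c0_summable (R : realType) (f : dual (c0 R)) :
  (fun n => f (c0_unit R n) : R[i]^o) \in @ell1_pred R.
Proof.
apply/ell1_predP; exists (rnorm f * 1) => N.
by apply: dual_summable => t; exact: c0_comb_norm.
Qed.

(** A functional [f] on c_0 is approximated by its truncations: the error takes at
the unit vectors the values of a tail of the summable sequence [f e_n]. *)
Lemma c0_arens_regular (R : realType) : arens_regular (c0 R).
Proof.
apply: (@arens_regular_dense_characters _ _ (@c0_coord R)) => [//|f e e0].
pose x := Ell1 (dual_c0_summable f).
have [K _ /(_ K (leqnn K)) /= xK] := ell1_tail x e0.
exists K, (fun n => x n); apply: dual_c0_norm_le => N.
rewrite (le_trans _ xK)//; apply: abs_series_truncated => n.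
rewrite -[LHS]/(f (c0_unit R n) -
    (\sum_(0 <= n < K) (x n : R[i]) *: c0_coord R n) (c0_unit R n)).
have -> : (\sum_(0 <= n < K) (x n : R[i]) *: c0_coord R n) (c0_unit R n) =
    (\sum_(0 <= n < K) (x n : R[i]) *: c0_unit R n) n.
  rewrite dual_sumE -[RHS]/(c0_coord R n _) linear_sum/=.
  apply: eq_bigr => i _; rewrite -[LHS]/(x i *: unit_seq R n i).
  by rewrite -[RHS]/(x i *: unit_seq R i n) /unit_seq eq_sym.
by rewrite c0_combE; case: ifP => _; rewrite ?subrr ?subr0.
Qed.

(** * The Banach algebra l_1 + c_0 *)

(** Together the families [unit1] and [unit2] form a Schauder basis of the algebra. *)
Definition unit1 (R : realType) n : ell1_c0 R := (ell1_unit R n, 0).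

Definition unit2 (R : realType) n : ell1_c0 R := (0, c0_unit R n).

Definition partial_unit (R : realType) k : ell1_c0 R := \sum_(0 <= n < k) unit2 R n.

Lemma ell1_c0_mulE (R : realType) (a b : ell1_c0 R) n :
  ((a ** b).1 n = a.1 n * b.2 n + b.1 n * a.2 n) *
  ((a ** b).2 n = a.2 n * b.2 n).
Proof. by case: a b => [x phi] [y psi]. Qed.

Lemma ell1_c0_eqP (R : realType) (a b : ell1_c0 R) :
  (forall n, a.1 n = b.1 n) -> (forall n, a.2 n = b.2 n) -> a = b.
Proof.
by case: a b => [x phi] [y psi] /= /ell1_eqP -> /c0_eqP ->.
Qed.

Lemma ell1_c0_mulC (R : realType) (a b : ell1_c0 R) : a ** b = b ** a.
Proof.
apply: ell1_c0_eqP => n; rewrite !ell1_c0_mulE; first by rewrite addrC.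
exact: mulrC.
Qed.

Lemma ell1_c0_sumE (R : realType) (u : nat -> ell1_c0 R) m n :
  ((\sum_(m <= i < n) u i).1 = \sum_(m <= i < n) (u i).1) *
  ((\sum_(m <= i < n) u i).2 = \sum_(m <= i < n) (u i).2).
Proof. by split; elim/big_rec2 : _ => // i x a _ <-. Qed.

Lemma partial_unitE (R : realType) k n :
  ((partial_unit R k).1 n = 0) * ((partial_unit R k).2 n = (n < k)%:R).
Proof.
rewrite /partial_unit !ell1_c0_sumE /= big1//; split=> //.
rewrite (_ : \sum_(0 <= i < k) _ = \sum_(0 <= i < k) (1 : R[i]) *: c0_unit R i).
  by rewrite (@c0_combE R (fun=> 1)); case: ifP.
by apply: eq_bigr => i _; rewrite scale1r.
Qed.

Lemma partial_unit_norm (R : realType) k : rnorm (partial_unit R k) <= 1.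
Proof.
rewrite rnorm_l1sumE rnorm_c0E (_ : (partial_unit R k).1 = 0); last first.
  by apply: ell1_eqP => n; rewrite partial_unitE.
rewrite rnorm0 add0r; apply: c0_norm_le => n; rewrite partial_unitE.
by case: ltnP => _; rewrite ?rnorm1// rnorm0 ler01.
Qed.

(** Multiplication by [partial_unit R k] truncates both components. *)
Lemma partial_unit_mul (R : realType) (a : ell1_c0 R) k :
  partial_unit R k ** a =
  \sum_(0 <= n < k) ((a.1 n : R[i]) *: unit1 R n + (a.2 n : R[i]) *: unit2 R n).
Proof.
rewrite [LHS]surjective_pairing [RHS]surjective_pairing !ell1_c0_sumE/=.
congr pair.
  rewrite (eq_bigr (fun n => (a.1 n : R[i]) *: ell1_unit R n)); last first.
    by move=> n _; rewrite scaler0 addr0.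
  apply: ell1_eqP => n; rewrite ell1_combE ell1_c0_mulE !partial_unitE.
  by rewrite mul0r add0r; case: ifP => _; rewrite ?mulr1 ?mulr0.
rewrite (eq_bigr (fun n => (a.2 n : R[i]) *: c0_unit R n)); last first.
  by move=> n _; rewrite scaler0 add0r.
apply: c0_eqP => n; rewrite c0_combE ell1_c0_mulE !partial_unitE.
by case: ifP => _; rewrite ?mul1r ?mul0r.
Qed.

Lemma partial_unit_cvg (R : realType) (a : ell1_c0 R) :
  partial_unit R k ** a @[k --> \oo] --> a.
Proof.
apply: cvg_rnorm => e e0; have e2 : 0 < e / 2 by rewrite divr_gt0.
have xe : \forall k \near \oo,
    rnorm (a.1 - \sum_(0 <= n < k) (a.1 n : R[i]) *: ell1_unit R n) <= e / 2.
  exact: (cvg_rnormP _ (@ell1_expansion R a.1) e2).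
have phie : \forall k \near \oo,
    rnorm (a.2 - \sum_(0 <= n < k) (a.2 n : R[i]) *: c0_unit R n) <= e / 2.
  exact: (cvg_rnormP _ (@c0_expansion R a.2) e2).
rewrite /nbhs/= /fmap/=; apply: filterS2 xe phie => k xk phik.
rewrite /= partial_unit_mul rnorm_l1sumE [leRHS]splitr.
rewrite [(_ - _).1](_ : _ = a.1 - \sum_(0 <= n < k) (a.1 n : R[i]) *: ell1_unit R n).
  rewrite [(_ - _).2](_ : _ = a.2 - \sum_(0 <= n < k) (a.2 n : R[i]) *: c0_unit R n).
    exact: lerD.
  rewrite [LHS]/= ell1_c0_sumE; congr (_ - _); apply: eq_bigr => n _ /=.
  by rewrite scaler0 add0r.
rewrite [LHS]/= ell1_c0_sumE; congr (_ - _); apply: eq_bigr => n _ /=.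
by rewrite scaler0 addr0.
Qed.

Lemma dual_expansion (R : realType) (f : dual (ell1_c0 R)) (a : ell1_c0 R) :
  (\sum_(0 <= n < k) (a.1 n * f (unit1 R n) + a.2 n * f (unit2 R n)) : R[i]^o)
    @[k --> \oo] --> f a.
Proof.
rewrite (_ : (fun k => _) = (fun k => f (partial_unit R k ** a) : R[i]^o)).
  exact: cvg_dual (@partial_unit_cvg R a).
apply/funext => k; rewrite partial_unit_mul linear_sum; apply: eq_bigr => n _.
by rewrite linearD !linearZ.
Qed.

Lemma coord1_linear (R : realType) n : linear (fun a : ell1_c0 R => a.1 n).
Proof. by []. Qed.

Lemma coord2_linear (R : realType) n : linear (fun a : ell1_c0 R => a.2 n).
Proof. by []. Qed.

Lemma coord1_le (R : realType) n (a : ell1_c0 R) : rnorm (a.1 n) <= 1 * rnorm a.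
Proof.
rewrite mul1r rnorm_l1sumE (le_trans (ell1_norm_coord a.1 n))//.
by rewrite lerDl rnorm_ge0.
Qed.

Lemma coord2_le (R : realType) n (a : ell1_c0 R) : rnorm (a.2 n) <= 1 * rnorm a.
Proof.
rewrite mul1r rnorm_l1sumE (le_trans (c0_norm_ge a.2 n))//.
by rewrite lerDr rnorm_ge0.
Qed.

Definition coord1 (R : realType) n : dual (ell1_c0 R) :=
  mk_dual (@coord1_linear R n) (ex_intro _ _ (@coord1_le R n)).

Definition coord2 (R : realType) n : dual (ell1_c0 R) :=
  mk_dual (@coord2_linear R n) (ex_intro _ _ (@coord2_le R n)).

Lemma coordE (R : realType) n (a : ell1_c0 R) :
  (coord1 R n a = a.1 n) * (coord2 R n a = a.2 n).
Proof. by []. Qed.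

(** On l_1 a combination of coordinates is bounded by the largest coefficient. *)
Lemma coord1_comb_norm (R : realType) (t : nat -> R[i]^o) N :
  (forall n, rnorm (t n) <= 1) ->
  rnorm (\sum_(0 <= n < N) (t n : R[i]) *: coord1 R n) <= 1.
Proof.
move=> t1; rewrite rnorm_dualE; apply: opnorm_le => a a1.
rewrite dual_sumE (le_trans (rnorm_sum _ _ _))//.
apply: (@le_trans _ _ (abs_series a.1 N)).
  apply: ler_sum => n _; rewrite dualZE coordE rnormZ.
  by rewrite ler_piMl ?rnorm_ge0.
rewrite (le_trans (ell1_norm_ge a.1 N))// (le_trans _ a1)// rnorm_l1sumE.
by rewrite lerDl rnorm_ge0.
Qed.

Lemma dual_unit2_summable (R : realType) (f : dual (ell1_c0 R)) :
  (fun n => f (unit2 R n) : R[i]^o) \in @ell1_pred R.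
Proof.
apply/ell1_predP; exists (rnorm f * 1) => N.
apply: dual_summable => t t1.
rewrite rnorm_l1sumE !ell1_c0_sumE big1 => [|i _]; last exact: scaler0.
by rewrite rnorm0 add0r; exact: c0_comb_norm.
Qed.

Lemma bidual_coord1_summable (R : realType) (m : dual (dual (ell1_c0 R))) :
  (fun n => m (coord1 R n) : R[i]^o) \in @ell1_pred R.
Proof.
apply/ell1_predP; exists (rnorm m * 1) => N.
by apply: dual_summable => t; exact: coord1_comb_norm.
Qed.

Lemma bidual_coord2_le (R : realType) (m : dual (dual (ell1_c0 R))) n :
  rnorm (m (coord2 R n)) <= rnorm m.
Proof.
rewrite (le_trans (dual_rnorm_le _ _))// ler_piMr ?rnorm_ge0//.
rewrite rnorm_dualE; apply: opnorm_le => a a1; rewrite coordE.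
by rewrite (le_trans (coord2_le n a))// mul1r.
Qed.

(** * Weak sequential completeness *)

(** The sequence 1, ..., 1, 0, ... of c_0 is weakly Cauchy because functionals are
summable along the unit vectors; a weak limit would be the constant sequence 1. *)
Lemma ell1_c0_not_wsc (R : realType) : ~ weakly_sequentially_complete (ell1_c0 R).
Proof.
move=> wsc; have [f|a ua] := wsc (@partial_unit R).
  pose x := Ell1 (dual_unit2_summable f).
  apply/cauchyP => e /complex_gt0P[r r0 ->].
  have r2 : 0 < r / 2 by rewrite divr_gt0.
  have [K _ /(_ K (leqnn K)) /= xK] := ell1_tail x r2.
  exists (f (partial_unit R K)); exists K => // k /= Kk.
  rewrite -ball_normE/= rnormE ltcR rnormB -linearB/=.
  rewrite /partial_unit (big_cat_nat (leq0n K) Kk)/= addrAC subrr add0r linear_sum.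
  rewrite (le_lt_trans (rnorm_sum _ _ _))// (le_lt_trans (abs_series_tail x Kk))//.
  by rewrite (le_lt_trans xK)// ltr_pdivrMr// ltr_pMr// ltr1n.
have a1 n : a.2 n = 1.
  apply: cvg_normed_unique (ua (coord2 R n)) _.
  apply: cvg_near_cst; exists n.+1 => // k /= nk.
  by rewrite -[LHS]/((partial_unit R k).2 n) partial_unitE nk.
have a21 : a.2 k @[k --> \oo] --> (1 : R[i]^o).
  by apply: cvg_near_cst; exact: nearW a1.
have /eqP : (0 : R[i]^o) = 1 by exact: cvg_normed_unique (@c0_cvg R a.2) a21.
by rewrite eq_sym oner_eq0.
Qed.

(** * Approximate identity *)

Lemma ell1_c0_contractive_ai (R : realType) : has_contractive_ai (ell1_c0 R).
Proof.
have tails_le : tails leq `=>` \oo.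
  by move=> S [N _ NS]; exists N.
exists nat, leq, (@partial_unit R); split=> [|k|a].
- split=> // [|i j k|i j]; [exact: inhabits 0%N|exact: leq_trans|].
  by exists (maxn i j); split; [exact: leq_maxl|exact: leq_maxr].
- by rewrite rnormE -(rmorph1 (real_complex R)) lecR partial_unit_norm.
- have ta : partial_unit R k ** a @[k --> tails leq] --> a.
    move=> S Sa; apply: tails_le; exact: partial_unit_cvg Sa.
  by split=> //; under eq_fun do rewrite ell1_c0_mulC.
Qed.

(** * Ideal in the bidual *)

Lemma unit_mul (R : realType) n (b : ell1_c0 R) :
  (unit1 R n ** b = (b.2 n : R[i]) *: unit1 R n) *
  (unit2 R n ** b = (b.1 n : R[i]) *: unit1 R n + (b.2 n : R[i]) *: unit2 R n).
Proof.
have unit_seqM (z : nat -> R[i]^o) i : z i * unit_seq R n i = z n * unit_seq R n i.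
  by rewrite /unit_seq; case: eqVneq => [->//|_]; rewrite !mulr0.
split; apply: ell1_c0_eqP => i; rewrite ell1_c0_mulE /=.
- by rewrite mulr0 addr0 mulrC unit_seqM.
- by rewrite mul0r -[RHS]/(b.2 n * 0) mulr0.
- rewrite mul0r add0r unit_seqM -[RHS]/(b.1 n * unit_seq R n i + b.2 n * 0).
  by rewrite mulr0 addr0.
- rewrite mulrC unit_seqM -[RHS]/(b.1 n * 0 + b.2 n * unit_seq R n i).
  by rewrite mulr0 add0r.
Qed.

Lemma dual_actr_unit (R : realType) (f : dual (ell1_c0 R)) n :
  (dual_actr f (unit1 R n) = (f (unit1 R n) : R[i]) *: coord2 R n) *
  (dual_actr f (unit2 R n) =
     (f (unit1 R n) : R[i]) *: coord1 R n + (f (unit2 R n) : R[i]) *: coord2 R n).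
Proof.
split; apply/dualP => b; rewrite dual_actE unit_mul.
  by rewrite linearZ dualZE coordE; exact: mulrC.
rewrite linearD !linearZ dualDE !dualZE !coordE.
by congr (_ + _); exact: mulrC.
Qed.

(** The product of [a] and [m] in the bidual is represented by the [b] whose
components are read off from [dual_actr_unit]: both sides of the equation then
have the same expansion along the unit vectors. *)
Lemma ell1_c0_bidual_actl (R : realType) (a : ell1_c0 R) (m : dual (dual (ell1_c0 R))) :
  exists b, forall f, m (dual_actr f a) = f b.
Proof.
have y1 : (fun n => a.1 n * m (coord2 R n) + a.2 n * m (coord1 R n) : R[i]^o)
    \in @ell1_pred R.
  pose x := Ell1 (bidual_coord1_summable m).
  apply/ell1_predP; exists (rnorm m * ell1_norm a.1 + rnorm a.2 * ell1_norm x) => N.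
  rewrite (le_trans (abs_seriesD _ _ _))// lerD//.
    rewrite (le_trans _ (ler_wpM2l (rnorm_ge0 m) (ell1_norm_ge a.1 N)))//.
    rewrite mulr_sumr; apply: ler_sum => n _; rewrite rnormM mulrC.
    by rewrite ler_wpM2r ?rnorm_ge0// bidual_coord2_le.
  rewrite (le_trans _ (ler_wpM2l (rnorm_ge0 a.2) (ell1_norm_ge x N)))//.
  rewrite mulr_sumr; apply: ler_sum => n _; rewrite rnormM.
  by rewrite ler_wpM2r ?rnorm_ge0// rnorm_c0E c0_norm_ge.
have y2 : (fun n => a.2 n * m (coord2 R n) : R[i]^o) \in @c0_pred R.
  apply/asboolP; apply: cvg_rnorm => e e0.
  have m1 : 0 < rnorm m + 1 by rewrite ltr_wpDl// rnorm_ge0.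
  have em : 0 < e / (rnorm m + 1) by rewrite divr_gt0.
  have ae : \forall n \near \oo, rnorm (0 - a.2 n) <= e / (rnorm m + 1).
    exact: (cvg_rnormP _ (@c0_cvg R a.2) em).
  rewrite /nbhs/= /fmap/=; apply: filterS ae => n /=.
  rewrite !sub0r !rnormN rnormM => an.
  rewrite (le_trans (ler_pM _ _ an (bidual_coord2_le m n))) ?rnorm_ge0//.
  by rewrite mulrAC ler_pdivrMr// ler_wpM2l ?(ltW e0)// lerDl.
exists (Ell1 y1, C0 y2) => f.
rewrite -(@bidual_actE _ _ m f a).
apply: cvg_normed_unique (@dual_expansion R (bidual_actl m f) a) _.
rewrite (_ : (fun k => _) = (fun k => \sum_(0 <= n < k)
   ((Ell1 y1) n * f (unit1 R n) + (C0 y2) n * f (unit2 R n)) : R[i]^o)).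
  exact: (@dual_expansion R f (Ell1 y1, C0 y2)).
apply/funext => k; apply: eq_bigr => n _ /=.
rewrite !dual_actr_unit linearD !linearZ mulrDr mulrDl -!mulrA.
rewrite addrA; congr (_ + _); last by congr (_ * _); exact: mulrC.
by congr (_ + _); congr (_ * _); exact: mulrC.
Qed.

(** By commutativity [a] acts on functionals in the same way from both sides, so
one [b] represents both products. *)
Lemma ell1_c0_ideal_in_bidual (R : realType) : ideal_in_bidual (ell1_c0 R).
Proof.
move=> a m; have [b mb] := ell1_c0_bidual_actl a m.
split; exists b; apply/dualP => f; rewrite arensE.
  by rewrite !bidual_embedE bidual_actE mb.
rewrite bidual_embedE -mb; congr (m _); apply/dualP => c.
by rewrite bidual_actE bidual_embedE !dual_actE ell1_c0_mulC.
Qed.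

(** * Arens irregularity *)

(** The summation functional of l_1, obtained as an ultralimit of its partial
sums. *)
Lemma ell1_sum_functional (R : realType) :
  exists f : dual (ell1_c0 R), forall n, f (unit1 R n) = 1.
Proof.
have [U [UU Uoo]] := ultraFilterLemma (F := \oo : set_system nat) _.
pose s k := \sum_(0 <= n < k) coord1 R n.
have s1 k : rnorm (s k) <= 1.
  rewrite /s (eq_bigr (fun n => (1 : R[i]) *: coord1 R n)); last first.
    by move=> n _; rewrite scale1r.
  by apply: (@coord1_comb_norm R (fun=> 1)) => _; rewrite rnorm1.
have [f sf] := dual_ultralimit UU s1; exists f => n.
apply: cvg_normed_unique (sf _) _.
apply: (@cvg_near_cst _ _ _ _ U); apply: Uoo; exists n.+1 => // k /= nk.
rewrite dual_sumE (eq_bigr (fun i => (i == n)%:R : R[i]^o)) => [|i _]; last first.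
  by rewrite coordE /= /unit_seq eq_sym.
rewrite big_mkord (bigD1 (Ordinal nk))//= eqxx big1 ?addr0// => i.
by rewrite -val_eqE/= => /negPf ->.
Qed.

(** At the summation functional the products of the unit vectors of l_1 with the
[partial_unit R j] form a triangular array of ones, with iterated limits 1 and
0. *)
Lemma ell1_c0_not_arens_regular (R : realType) : ~ arens_regular (ell1_c0 R).
Proof.
have [U [UU Uoo]] := ultraFilterLemma (F := \oo : set_system nat) _.
have [f f1] := ell1_sum_functional R.
have fE k j : f (unit1 R k ** partial_unit R j) = (k < j)%:R.
  by rewrite unit_mul linearZ/= f1 partial_unitE; exact: mulr1.
have u1 k : rnorm (unit1 R k) <= 1.
  rewrite rnorm_l1sumE /= rnorm0 addr0 rnorm_ell1E.
  by apply: ell1_norm_le => N; exact: abs_series_unit_seq.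
move=> reg; have /eqP : (1 : R[i]^o) = 0.
  apply: (arens_regular_iterated_limits (f := f) UU u1 (@partial_unit_norm R) _ _ _ _ reg).
  - move=> k; apply: (@cvg_near_cst _ _ _ _ U); apply: Uoo; exists k.+1 => // j /= kj.
    by rewrite fE kj.
  - exact: cvg_cst.
  - move=> j; apply: (@cvg_near_cst _ _ _ _ U); apply: Uoo; exists j => // k /= jk.
    by rewrite fE ltnNge jk.
  - exact: cvg_cst.
by rewrite oner_eq0.
Qed.

(** * The ideal l_1 and its quotient *)

Definition ell1_part (R : realType) : set (ell1_c0 R) := [set a | a.2 = 0].

Lemma ell1_part_closed (R : realType) : closed (@ell1_part R).
Proof.
move=> a aJ; apply: rnorm_le_eq0 => e e0.
have e0' : 0 < e%:C by rewrite ltcR.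
have [b [Jb /=]] := aJ _ (nbhsx_ballx a _ e0').
rewrite -ball_normE/= rnormE ltcR => /ltW; apply: le_trans.
rewrite -[a.2]subr0 -[X in _ - X]Jb rnorm_l1sumE.
by rewrite lerDr rnorm_ge0.
Qed.

Lemma ell1_part_subspace (R : realType) : vector_subspace (@ell1_part R).
Proof.
split=> // k a b; rewrite /ell1_part/= => -> ->.
by rewrite scaler0 addr0.
Qed.

Lemma ell1_part_mull (R : realType) (a x : ell1_c0 R) :
  ell1_part x -> ell1_part (a ** x).
Proof.
rewrite /ell1_part/= => x0; apply: c0_eqP => n.
by rewrite ell1_c0_mulE x0 mulr0.
Qed.

Lemma ell1_part_mulr (R : realType) (a x : ell1_c0 R) :
  ell1_part x -> ell1_part (x ** a).
Proof. by move=> x0; rewrite ell1_c0_mulC; exact: ell1_part_mull. Qed.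

Definition ell1_ideal (R : realType) : closed_ideal (ell1_c0 R) :=
  ClosedIdeal (@ell1_part_closed R) (@ell1_part_subspace R)
    (@ell1_part_mull R) (@ell1_part_mulr R).

Lemma arens_regular_zero_product (R : realType) (A : normedAlgType R[i]) :
  (forall a b : A, a ** b = 0) -> arens_regular A.
Proof.
move=> mul0; apply/arens_regularE => m n; apply/dualP => f; rewrite !arensE.
have actr0 a : dual_actr f a = 0.
  by apply/dualP => b; rewrite dual_actE mul0; exact: (linear0 f).
have actl0 a : dual_actl a f = 0.
  by apply/dualP => b; rewrite dual_actE mul0; exact: (linear0 f).
have -> : bidual_actl n f = 0.
  by apply/dualP => a; rewrite bidual_actE actr0; exact: (linear0 n).
have -> : bidual_actr f m = 0.
  by apply/dualP => a; rewrite bidual_actE actl0; exact: (linear0 m).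
exact: etrans (linear0 m) (esym (linear0 n)).
Qed.

Lemma ell1_ideal_arens_regular (R : realType) : arens_regular (ideal_type (ell1_ideal R)).
Proof.
apply: arens_regular_zero_product => -[a aJ] [b bJ]; apply: val_inj => /=.
move/asboolP : aJ => a0; move/asboolP : bJ => b0.
apply: ell1_c0_eqP => n; rewrite ell1_c0_mulE a0 b0; last exact: mulr0.
by rewrite !mulr0 addr0.
Qed.

(** The second component identifies the quotient with c_0. *)
Lemma ell1_quotient_arens_regular (R : realType) :
  arens_regular (quotient_type (ell1_ideal R)).
Proof.
set J := ell1_ideal R.
pose k (q : quotient_type J) : c0 R := (quotient_repr q).2.
pose h (phi : c0 R) : quotient_type J := quotient_map J ((0, phi) : ell1_c0 R).
have kE a : k (quotient_map J a) = a.2.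
  have /quotient_mapP := quotient_reprK (quotient_map J a).
  by move/eqP; rewrite subr_eq0 => /eqP.
have lk : linear k.
  move=> c q r; have [a ->] := quotient_map_surj q.
  have [b ->] := quotient_map_surj r.
  by rewrite -quotient_mapZE -quotient_mapD !kE.
have lh : linear h.
  move=> c phi psi; rewrite /h -quotient_mapZE -quotient_mapD; congr (quotient_map J _).
  by apply: ell1_c0_eqP => n //=; rewrite scaler0 addr0.
have k1 q : rnorm (k q) <= 1 * rnorm q.
  rewrite mul1r; apply/ler_addgt0Pr => e e0.
  have [a [<- ae]] := quotient_norm_approx q e0.
  rewrite kE (le_trans _ (ltW ae))// rnorm_l1sumE.
  by rewrite lerDr rnorm_ge0.
have h1 phi : rnorm (h phi) <= 1 * rnorm phi.
  rewrite mul1r rnorm_quotientE (le_trans (quotient_norm_le _ _))//.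
  by rewrite rnorm_l1sumE/= rnorm0 add0r.
apply: (arens_regular_retract lk lh k1 h1) (@c0_arens_regular R).
  move=> q r; have [a ->] := quotient_map_surj q.
  have [b ->] := quotient_map_surj r.
  rewrite -[_ ** _]/(quotient_mul _ _) quotient_mapM !kE.
  by apply: c0_eqP => n; rewrite ell1_c0_mulE.
move=> q; have [a ->] := quotient_map_surj q; rewrite /h kE.
apply/quotient_mapP; rewrite -[ideal_set _ _]/(a.2 - a.2 = 0).
exact: subrr.
Qed.

Theorem mainTheorem3 (R : realType) :
  ~ weakly_sequentially_complete (ell1_c0 R) /\
  ~ standard (ell1_c0 R) /\
  has_contractive_ai (ell1_c0 R) /\
  ideal_in_bidual (ell1_c0 R) /\
  (exists J : closed_ideal (ell1_c0 R),
     arens_regular (ideal_type J) /\ arens_regular (quotient_type J)) /\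
  ~ arens_regular (ell1_c0 R).
Proof.
split; first exact: ell1_c0_not_wsc.
split; first by move=> [[wsc _ _] _]; exact: ell1_c0_not_wsc wsc.
split; first exact: ell1_c0_contractive_ai.
split; first exact: ell1_c0_ideal_in_bidual.
split; last exact: ell1_c0_not_arens_regular.
exists (ell1_ideal R); split; first exact: ell1_ideal_arens_regular.
exact: ell1_quotient_arens_regular.
Qed.
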